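(* Let $p$ be a prime, let $n\geq 1$ be an integer, and let $l=l(n)$. Let $e_0,\dots,e_n$ be the standard basis of $\mathbb{F}_p^{n+1}$ and let $\mu:\mathbb{F}_p^{n+1}\to\mathcal{P}^n$ be the $\mathbb{F}_p$-linear map with $\mu(e_i)=P^i\,\chi P^{n-i}$ for $0\leq i\leq n$, so that $\ker\mu$ is the space of linear relations among the elements $P^i\,\chi P^{n-i}$, $0\leq i\leq n$. Then: (a) For every integer $m$, the $l+1$ vectors $$\sum_{i=0}^{n}\binom{k-i}{l}e_i,\qquad m\leq k\leq m+l,$$ form a basis of $\ker\mu$; that is, any $l+1$ consecutive (in the integer $k$) relations from the family $\sum_{i}\binom{k-i}{l}P^i\,\chi P^{n-i}=0$ form a basis of the relations among the elements of $\{P^i\,\chi P^{n-i}:0\leq i\leq n\}$. (b) The set $\{P^i\,\chi P^{n-i}: l(n)+1\leq i\leq n\}$ is a basis of $V_n=\mathrm{Span}_{\mathbb{F}_p}\{P^i\,\chi P^{n-i}:0\leq i\leq n\}\subseteq\mathcal{P}^n$.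
   Context: $\mathcal{P}$ denotes the Hopf algebra over $\mathbb{F}_p$ of Steenrod reduced powers: for $p$ odd, the subalgebra of the mod $p$ Steenrod algebra generated by the reduced powers $P^n$, $n\ge0$ ($P^0=1$); for $p=2$, $P^n$ denotes $\mathrm{Sq}^n$ and $\mathcal{P}$ is the full mod $2$ Steenrod algebra. It is graded so that $P^n$ has degree $n$, and $\mathcal{P}^n$ denotes the degree $n$ part. The coproduct is determined by $\Delta P^n=\sum_i P^i\otimes P^{n-i}$. The map $\chi$ is the Hopf algebra anti-automorphism of $\mathcal{P}$, determined by $\chi P^0=P^0$ and $\sum_{i=0}^n P^i\,\chi P^{n-i}=0$ for $n>0$. For an integer $j\geq0$, $\alpha(j)$ is the sum of the digits of the base-$p$ expansion of $j$. For $n\geq1$, $$l(n)=\max\{j\geq0: pj-\alpha(j)<(p-1)n\}.$$ For an integer $x$ (possibly negative) and $l\geq0$, $\binom{x}{l}=x(x-1)\cdots(x-l+1)/l!$, an integer, reduced mod $p$ when used as a coefficient over $\mathbb{F}_p$. *)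

(* Defs.v *)
From HB Require Import structures.
From mathcomp Require Import all_boot all_order all_algebra.
From mathcomp Require Import boolp monalg ring.

Set Implicit Arguments.
Unset Strict Implicit.
Unset Printing Implicit Defensive.

Import Order.TTheory GRing.Theory Num.Theory.

Local Open Scope ring_scope.
Local Open Scope quotient_scope.

Lemma malg_scalerAr (R : comNzRingType) (M : monomType) (c : R)
  (x y : {malg R[M]}) : c *: (x * y) = x * (c *: y).
Proof.
rewrite -(mul_malgC c y) -mul_malgC !mulrA; congr (_ * y).
rewrite (monalgE x) mulr_sumr mulr_suml; apply: eq_bigr => k _.
rewrite -[LHS]/(fgmul _ _) -[RHS]/(fgmul _ _).
by rewrite !fgmulUU mul1m mulm1 mulrC.
Qed.

(* The mod p Steenrod algebra, as the quotient of the free associative algebra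
   on the letters beta = None and P^n = Some n by the two-sided ideal generated
   by P^0 - 1, the Adem relations and, for p odd, beta^2.  For p = 2, P^n is
   Sq^n and the letter beta is identified with Sq^1; the mod 2 Adem relations
   are the case p = 2 of the formula for P^a P^b. *)

Section FreeAlgebra.
Variable p : nat.

Definition freeAlg := {malg 'F_p[{fmonom (option nat)}]}.
HB.instance Definition _ := GRing.Lalgebra.on freeAlg.
HB.instance Definition _ := GRing.Lalgebra_isAlgebra.Build 'F_p freeAlg
  (@malg_scalerAr _ _).

Definition free_letter (i : option nat) : freeAlg := mkmalgU (fmu i) 1.
Local Notation beta := (free_letter None).
Local Notation P n := (free_letter (Some (n%N : nat))).

Definition signed_bin (e m k : nat) : 'F_p := (-1) ^+ e * 'C(m, k)%:R.

Inductive steenrod_relator : freeAlg -> Prop :=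
| Rel_P0 : steenrod_relator (P 0 - 1)
| Rel_Adem a b of (0 < a < p * b)%N : steenrod_relator
    (P a * P b
     - \sum_(j < a.+1 | (p * j <= a)%N)
         signed_bin (a + j) ((p - 1) * (b - j) - 1) (a - p * j)
           *: (P (a + b - j) * P j))
| Rel_beta_two of p = 2%N : steenrod_relator (beta - P 1)
| Rel_beta_sq of odd p : steenrod_relator (beta * beta)
| Rel_Adem_beta a b of odd p & (0 < a <= p * b)%N : steenrod_relator
    (P a * beta * P b
     - (\sum_(j < a.+1 | (p * j <= a)%N)
          signed_bin (a + j) ((p - 1) * (b - j)) (a - p * j)
            *: (beta * P (a + b - j) * P j)
        + \sum_(j < a.+1 | (p * j + 1 <= a)%N)
            signed_bin (a + j + 1) ((p - 1) * (b - j) - 1) (a - p * j - 1)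
              *: (P (a + b - j) * beta * P j))).

Inductive steenrod_ideal : freeAlg -> Prop :=
| Ideal_relator x of steenrod_relator x : steenrod_ideal x
| Ideal_zero : steenrod_ideal 0
| Ideal_sub x y of steenrod_ideal x & steenrod_ideal y : steenrod_ideal (x - y)
| Ideal_mul x y z of steenrod_ideal y : steenrod_ideal (x * y * z).

(* Used only to see that the quotient is not the zero ring. *)
Definition aug_word (m : {fmonom (option nat)}) : 'F_p :=
  (all (pred1 (Some 0%N)) m)%:R.

Fact aug_word1 : aug_word mone = 1. Proof. by rewrite /aug_word fm1. Qed.

Fact aug_wordM : {morph aug_word : x y / mmul x y >-> x * y}.
Proof. by move=> x y; rewrite /aug_word fmM all_cat -mulnb natrM. Qed.
HB.instance Definition _ :=
  monalg.isMultiplicative.Build {fmonom (option nat)} 'F_p aug_word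
    (conj aug_wordM aug_word1).

Definition aug : freeAlg -> 'F_p := mmap idfun aug_word.

Fact aug_letter i : aug (free_letter i) = (i == Some 0%N)%:R.
Proof. by rewrite /aug mmapU /aug_word fmU /= mul1r andbT. Qed.

Fact augM : {morph aug : x y / x * y}. Proof. exact: rmorphM. Qed.
Fact augB : {morph aug : x y / x - y}. Proof. exact: raddfB. Qed.
Fact augD : {morph aug : x y / x + y}. Proof. exact: raddfD. Qed.
Fact augZ c x : aug (c *: x) = c * aug x. Proof. exact: mmapZ. Qed.
Fact aug1 : aug 1 = 1. Proof. exact: mmap1. Qed.
Fact aug0 : aug 0 = 0. Proof. exact: mmap0. Qed.
Fact aug_sum0 (I : finType) (D : pred I) (F : I -> freeAlg) :
  (forall i, D i -> aug (F i) = 0) -> aug (\sum_(i | D i) F i) = 0.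
Proof. by move=> F0; rewrite (big_morph aug augD aug0) big1. Qed.

Fact aug_ideal x : steenrod_ideal x -> aug x = 0.
Proof.
elim=> {x}; last 1 first.
- by move=> x y z _ y0; rewrite !augM y0 mulr0 mul0r.
- move=> x; case.
  + by rewrite augB aug_letter aug1 subrr.
  + move=> a b /andP[a0 ab]; rewrite augB augM !aug_letter.
    rewrite aug_sum0 => [|j pj]; last first.
      rewrite augZ augM !aug_letter.
      have jb : (j < b)%N.
        have: (p * j < p * b)%N by apply: leq_ltn_trans pj ab.
        by rewrite ltn_mul2l => /andP[].
      rewrite (_ : _ == _ = false) ?mul0r ?mulr0 //.
      apply/negP=> /eqP[] /eqP; rewrite -leqn0 leqNgt subn_gt0.
      by rewrite (leq_trans jb) // leq_addl.
    by case: a a0 {ab} => // a _; rewrite mul0r subrr.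
  + by move=> _; rewrite augB !aug_letter subrr.
  + by move=> _; rewrite augM !aug_letter mul0r.
  + move=> a b _ _; rewrite augB augD.
    have sub0D (u v w : 'F_p) : u = 0 -> v = 0 -> w = 0 -> u - (v + w) = 0.
      by move=> -> -> ->; rewrite addr0 subrr.
    apply: sub0D; last 2 first.
    * by apply: aug_sum0 => j _; rewrite augZ !augM (aug_letter None) !mul0r mulr0.
    * apply: aug_sum0 => j _.
      by rewrite augZ !augM (aug_letter None) mulr0 mul0r mulr0.
    * by rewrite !augM (aug_letter None) mulr0 mul0r.
- exact: aug0.
- by move=> x y _ x0 _ y0; rewrite augB x0 y0 subrr.
Qed.

Definition steenrod_ideal_pred : freeAlg -> bool := fun x => `[< steenrod_ideal x >].

Fact steenrod_ideal_zmod_closed : zmod_closed steenrod_ideal_pred.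
Proof.
split=> [|x y /asboolP xI /asboolP yI]; apply/asboolP; first exact: Ideal_zero.
exact: Ideal_sub.
Qed.

HB.instance Definition _ :=
  GRing.isZmodClosed.Build freeAlg steenrod_ideal_pred steenrod_ideal_zmod_closed.

Definition steenrod := 
  Quotient.quot (GRing.ZmodClosed.clone freeAlg steenrod_ideal_pred _).
HB.instance Definition _ := GRing.Zmodule.on steenrod.

Definition toS (x : freeAlg) : steenrod := \pi x.
Definition ofS (x : steenrod) : freeAlg := repr x.

Fact ofSK : cancel ofS toS. Proof. exact: reprK. Qed.

Fact toS_eqP x y : toS x = toS y <-> steenrod_ideal (x - y).
Proof.
rewrite /toS; split=> [/eqP|] => xy.
  by move: xy; rewrite -Quotient.idealrBE => /asboolP.
by apply/eqP; rewrite -Quotient.idealrBE; apply/asboolP.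
Qed.

Fact toSB : {morph toS : x y / x - y}. Proof. by move=> x y; rewrite /toS !piE. Qed.
Fact toSD : {morph toS : x y / x + y}. Proof. by move=> x y; rewrite /toS !piE. Qed.

Definition steenrod_mul (x y : steenrod) : steenrod := toS (ofS x * ofS y).
Definition steenrod_scale (c : 'F_p) (x : steenrod) : steenrod := toS (c *: ofS x).

Fact mul_sub_mul (R : pzRingType) (x y x' y' : R) :
  x * y - x' * y' = 0 - (x' * (y' - y)) - ((x' - x) * y).
Proof.
by rewrite mulrBr mulrBl sub0r !opprB [RHS]addrC addrA subrK.
Qed.

Fact toSM : {morph toS : x y / x * y >-> steenrod_mul x y}.
Proof.
have idealM a b : steenrod_ideal b ->
    steenrod_ideal (a * b) /\ steenrod_ideal (b * a).
  move=> b0; split; first by rewrite -[a * b]mulr1; apply: Ideal_mul.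
  by rewrite -[b]mul1r; apply: Ideal_mul.
move=> x y; apply/toS_eqP; rewrite mul_sub_mul.
have /toS_eqP dx := ofSK (toS x); have /toS_eqP dy := ofSK (toS y).
apply: Ideal_sub; last exact: (idealM y _ _).2.
by apply: Ideal_sub; [exact: Ideal_zero | exact: (idealM (ofS (toS x)) _ _).1].
Qed.

Fact toSZ c : {morph toS : x / c *: x >-> steenrod_scale c x}.
Proof.
move=> x; apply/toS_eqP; have /toS_eqP dx := ofSK (toS x).
rewrite -scalerBr -opprB scalerN -scaleNr -[_ - x]mul1r scalerAl.
by rewrite -[_ * _]mulr1; apply: Ideal_mul.
Qed.

Fact steenrod_mulA : associative steenrod_mul.
Proof.
by move=> x y z; rewrite -[x]ofSK -[y]ofSK -[z]ofSK -!toSM mulrA.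
Qed.
Fact steenrod_mul1l : left_id (toS 1) steenrod_mul.
Proof. by move=> x; rewrite -[x]ofSK -!toSM mul1r. Qed.
Fact steenrod_mul1r : right_id (toS 1) steenrod_mul.
Proof. by move=> x; rewrite -[x]ofSK -!toSM mulr1. Qed.
Fact steenrod_mulDl : left_distributive steenrod_mul +%R.
Proof.
by move=> x y z; rewrite -[x]ofSK -[y]ofSK -[z]ofSK -!(toSM, toSD) mulrDl.
Qed.
Fact steenrod_mulDr : right_distributive steenrod_mul +%R.
Proof.
by move=> x y z; rewrite -[x]ofSK -[y]ofSK -[z]ofSK -!(toSM, toSD) mulrDr.
Qed.
Fact steenrod_1_neq0 : toS 1 != 0.
Proof.
have -> : 0 = toS 0 by rewrite /toS piE.
apply/eqP=> /toS_eqP; rewrite subr0 => /aug_ideal /eqP.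
by rewrite aug1 oner_eq0.
Qed.

HB.instance Definition _ := GRing.Zmodule_isNzRing.Build steenrod
  steenrod_mulA steenrod_mul1l steenrod_mul1r steenrod_mulDl steenrod_mulDr
  steenrod_1_neq0.

Fact steenrod_scalerA a b x :
  steenrod_scale a (steenrod_scale b x) = steenrod_scale (a * b) x.
Proof. by rewrite -[x]ofSK -!toSZ scalerA. Qed.
Fact steenrod_scale1 : left_id 1 steenrod_scale.
Proof. by move=> x; rewrite -[x]ofSK -toSZ scale1r. Qed.
Fact steenrod_scaleDr : right_distributive steenrod_scale +%R.
Proof.
by move=> a x y; rewrite -[x]ofSK -[y]ofSK -!(toSZ, toSD) scalerDr.
Qed.
Fact steenrod_scaleDl x : {morph steenrod_scale^~ x : a b / a + b}.
Proof. by move=> a b; rewrite -[x]ofSK -!(toSZ, toSD) scalerDl. Qed.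

HB.instance Definition _ := GRing.Zmodule_isLmodule.Build 'F_p steenrod
  steenrod_scalerA steenrod_scale1 steenrod_scaleDr steenrod_scaleDl.

Fact steenrod_scaleAl a (x y : steenrod) : a *: (x * y) = a *: x * y.
Proof.
rewrite -[x]ofSK -[y]ofSK.
by rewrite -[LHS]/(steenrod_scale _ (steenrod_mul _ _))
  -[RHS]/(steenrod_mul (steenrod_scale _ _) _) -!(toSZ, toSM) scalerAl.
Qed.

HB.instance Definition _ :=
  GRing.Lmodule_isLalgebra.Build 'F_p steenrod steenrod_scaleAl.

Fact steenrod_scaleAr a (x y : steenrod) : a *: (x * y) = x * (a *: y).
Proof.
rewrite -[x]ofSK -[y]ofSK.
by rewrite -[LHS]/(steenrod_scale _ (steenrod_mul _ _))
  -[RHS]/(steenrod_mul _ (steenrod_scale _ _)) -!(toSZ, toSM) scalerAr.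
Qed.

HB.instance Definition _ :=
  GRing.Lalgebra_isAlgebra.Build 'F_p steenrod steenrod_scaleAr.

Fact toS_linear : linear toS.
Proof. by move=> a x y; rewrite toSD toSZ. Qed.
Fact toS_monoid_morphism : monoid_morphism toS.
Proof. by split; [exact: erefl | exact: toSM]. Qed.

HB.instance Definition _ :=
  GRing.isLinear.Build 'F_p freeAlg steenrod *:%R toS toS_linear.
HB.instance Definition _ :=
  GRing.isMonoidMorphism.Build freeAlg steenrod toS toS_monoid_morphism.

Fact toS_eq0 x : toS x = 0 <-> steenrod_ideal x.
Proof. by rewrite -(raddf0 toS) toS_eqP subr0. Qed.

End FreeAlgebra.

(* The algebra of reduced powers: the subalgebra of [steenrod p] generated by
   the P^n.  For p = 2 it is everything, cf. [reduced2_full]. *)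

Inductive in_reduced (p : nat) : steenrod p -> Prop :=
| Reduced_P n : in_reduced (toS (free_letter p (Some n)))
| Reduced_1 : in_reduced 1
| Reduced_mul x y of in_reduced x & in_reduced y : in_reduced (x * y)
| Reduced_lin a x y of in_reduced x & in_reduced y : in_reduced (a *: x + y).

Section ReducedPowers.
Variable p : nat.

Definition reduced_pred : steenrod p -> bool := fun x => `[< in_reduced x >].

Fact reduced_subalg_closed : subalg_closed reduced_pred.
Proof.
split=> [|a x y /asboolP xR /asboolP yR|x y /asboolP xR /asboolP yR];
  apply/asboolP; [exact: Reduced_1 | exact: Reduced_lin | exact: Reduced_mul].
Qed.

HB.instance Definition _ :=
  GRing.isSubalgClosed.Build 'F_p (steenrod p) reduced_pred
    (GRing.subalg_closed_semi reduced_subalg_closed).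

Record reduced := Reduced { reduced_val : steenrod p; _ : reduced_pred reduced_val }.

HB.instance Definition _ := [isSub for reduced_val].
HB.instance Definition _ := [Choice of reduced by <:].
HB.instance Definition _ := [SubChoice_isSubAlgebra of reduced by <:].

Fact Pow_subproof n : reduced_pred (toS (free_letter p (Some n))).
Proof. by apply/asboolP; apply: Reduced_P. Qed.

Definition Pow n : reduced := Reduced (Pow_subproof n).

(* The values chi P^0, ..., chi P^n of the anti-automorphism chi, computed from
   chi P^0 = P^0 and sum_i P^i (chi P^(n-i)) = 0. *)
Fixpoint chiPow_seq n : seq reduced :=
  if n is m.+1 then
    let s := chiPow_seq m in
    rcons s (- \sum_(i < m.+1) Pow i.+1 * s`_(m - i))
  else [:: Pow 0].

Definition chiPow n : reduced := (chiPow_seq n)`_n.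

Fact size_chiPow_seq n : size (chiPow_seq n) = n.+1.
Proof. by elim: n => //= n IHn; rewrite size_rcons IHn. Qed.

Fact nth_chiPow_seq n i : (i <= n)%N -> (chiPow_seq n)`_i = chiPow i.
Proof.
elim: n => [|n IHn]; first by rewrite leqn0 => /eqP->.
rewrite leq_eqVlt => /predU1P[-> //|lt_i].
by rewrite /= nth_rcons size_chiPow_seq lt_i IHn.
Qed.

Lemma Pow0 : Pow 0 = 1.
Proof.
apply/val_inj/eqP; rewrite /= -subr_eq0; apply/eqP.
have -> : 1 = toS (1 : freeAlg p) by rewrite rmorph1.
by rewrite -raddfB; apply/toS_eq0/Ideal_relator/Rel_P0.
Qed.

Lemma chiPow0 : chiPow 0 = Pow 0. Proof. by []. Qed.

Lemma chiPow_rec n : (0 < n)%N -> \sum_(i < n.+1) Pow i * chiPow (n - i) = 0.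
Proof.
case: n => // n _; rewrite big_ord_recl Pow0 mul1r subn0 {1}/chiPow /=.
rewrite nth_rcons size_chiPow_seq ltnn eqxx addrC; apply/eqP.
rewrite subr_eq0; apply/eqP/eq_bigr => i _.
by rewrite nth_chiPow_seq ?leq_subr // /bump /= add1n subSS.
Qed.

Lemma chiPow_unique (chi : reduced -> reduced) :
    chi (Pow 0) = Pow 0 ->
    (forall n, (0 < n)%N -> \sum_(i < n.+1) Pow i * chi (Pow (n - i)%N) = 0) ->
  forall n, chi (Pow n) = chiPow n.
Proof.
move=> chi0 chiS; elim/ltn_ind => -[//|n] IHn.
have := chiPow_rec (ltn0Sn n); rewrite big_ord_recl Pow0 mul1r subn0 => e1.
have := chiS n.+1 isT; rewrite big_ord_recl Pow0 mul1r subn0 => e2.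
move: e2; rewrite (eq_bigr (fun i : 'I_n.+1 =>
    Pow (lift ord0 i) * chiPow (n.+1 - lift ord0 i))) => [e2|i _].
  exact: addIr (etrans e2 (esym e1)).
by rewrite IHn // lift0 subSS ltnS leq_subr.
Qed.

(* [in_degree n] is the degree n part, with P^n in degree n. *)
Inductive in_degree : nat -> reduced -> Prop :=
| Degree_1 : in_degree 0 1
| Degree_P n : in_degree n (Pow n)
| Degree_mul m n x y of in_degree m x & in_degree n y : in_degree (m + n) (x * y)
| Degree_lin n a x y of in_degree n x & in_degree n y : in_degree n (a *: x + y).

Definition PchiP n i : reduced := Pow i * chiPow (n - i).

Fact in_degree_sum n (I : finType) (F : I -> reduced) :
  (forall i, in_degree n (F i)) -> in_degree n (\sum_i F i).
Proof.
move=> Fn; apply: (big_ind (in_degree n)) => // [|x y xn yn].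
  by rewrite -(addNr (Pow n)) -scaleN1r; apply: Degree_lin; apply: Degree_P.
by rewrite -[x]scale1r; apply: Degree_lin.
Qed.

Lemma in_degree_chiPow n : in_degree n (chiPow n).
Proof.
elim/ltn_ind: n => -[_|n IHn]; first exact: Degree_P.
rewrite /chiPow /= nth_rcons size_chiPow_seq ltnn eqxx.
have S : in_degree n.+1
    (\sum_(i < n.+1) Pow i.+1 * (chiPow_seq n)`_(n - i)).
  apply: in_degree_sum => i; rewrite nth_chiPow_seq ?leq_subr //.
  have lt_ni : (n - i < n.+1)%N by rewrite ltnS leq_subr.
  have := Degree_mul (Degree_P i.+1) (IHn _ lt_ni).
  by rewrite addSn subnKC // -ltnS.
rewrite -[- _]addr0 -scaleN1r; apply: Degree_lin => //.
by rewrite -(addNr (Pow n.+1)) -scaleN1r; apply: Degree_lin; apply: Degree_P.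
Qed.

Lemma in_degree_PchiP n i : (i <= n)%N -> in_degree n (PchiP n i).
Proof.
move=> le_in; have := Degree_mul (Degree_P i) (in_degree_chiPow (n - i)).
by rewrite subnKC.
Qed.

Definition mu n (v : 'rV['F_p]_n.+1) : reduced := \sum_i v 0 i *: PchiP n i.

Fact mu_linear n : linear (@mu n).
Proof.
move=> a u v; rewrite /mu scaler_sumr -big_split; apply: eq_bigr => i _.
by rewrite !mxE scalerDl scalerA.
Qed.

HB.instance Definition _ n :=
  GRing.isLinear.Build 'F_p 'rV['F_p]_n.+1 reduced *:%R (@mu n) (@mu_linear n).

Lemma mu_delta n (i : 'I_n.+1) : mu (delta_mx 0 i) = PchiP n i.
Proof.
rewrite /mu (bigD1 i) //= big1 => [|j ji]; first by rewrite !mxE !eqxx scale1r addr0.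
by rewrite !mxE (negPf ji) andbF scale0r.
Qed.

Lemma mu_degree n v : in_degree n (@mu n v).
Proof.
apply: in_degree_sum => i; rewrite -[_ *: _]addr0; apply: Degree_lin.
  by apply: in_degree_PchiP; rewrite -ltnS.
by rewrite -(addNr (Pow n)) -scaleN1r; apply: Degree_lin; apply: Degree_P.
Qed.

(* As 'rV['F_p]_n.+1 is a finite type, the kernel can be spanned by the list of
   all its elements; [mem_kermu] is the defining property. *)
Definition kermu n : {vspace 'rV['F_p]_n.+1} :=
  <<[seq v <- enum 'rV['F_p]_n.+1 | mu v == 0%R]>>%VS.

Lemma mem_kermu n v : (v \in kermu n) = (mu v == 0).
Proof.
apply/idP/idP => [vK|v0]; last first.
  by apply: memv_span; rewrite mem_filter v0 mem_enum.
rewrite (@coord_span _ _ _ (in_tuple _) _ vK) linear_sum big1 // => i _.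
rewrite linearZ; have := mem_nth 0 (ltn_ord i).
rewrite mem_filter => /andP[/eqP e _]; apply: etrans (scaler0 _ _).
by congr (_ *: _); exact: e.
Qed.
End ReducedPowers.

Lemma reduced2_full (x : steenrod 2) : in_reduced x.
Proof.
have letterP i : in_reduced (toS (free_letter 2 i)).
  case: i => [n|]; first exact: Reduced_P.
  rewrite (_ : toS _ = toS (free_letter 2 (Some 1%N))); first exact: Reduced_P.
  by apply/toS_eqP/Ideal_relator/Rel_beta_two.
have wordP s : in_reduced (toS (mkmalgU (FMonom s) 1 : freeAlg 2)).
  elim: s => [|i s IHs].
    rewrite (_ : toS _ = 1); first exact: Reduced_1.
    by rewrite -(rmorph1 (@toS 2)); congr toS; rewrite -fmoneE.
  rewrite (_ : toS _ = toS (free_letter 2 i) * toS (mkmalgU (FMonom s) 1 : freeAlg 2)).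
    exact: Reduced_mul.
  rewrite -rmorphM; congr toS; rewrite -[RHS]/(fgmul _ _) fgmulUU mulr1.
  by congr mkmalgU; rewrite -[RHS]/(fmmul _ _) fmmulE fmuE.
have red0 : in_reduced (0 : steenrod 2).
  by rewrite -(addNr 1) -scaleN1r; apply: Reduced_lin; exact: Reduced_1.
have scaleP c (y : freeAlg 2) : in_reduced (toS y) -> in_reduced (toS (c *: y)).
  have -> : toS (c *: y) = c *: toS y + 0 by rewrite addr0; exact: toSZ.
  by move=> yR; apply: Reduced_lin.
rewrite -(ofSK x) (monalgE (ofS x)) raddf_sum.
apply: (big_ind (@in_reduced 2)) => // [a b aR bR|k _].
  by rewrite -[a]scale1r; apply: Reduced_lin.
have -> : mkmalgU k (ofS x)@_k = (ofS x)@_k *: (mkmalgU k 1 : freeAlg 2).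
  apply/malgP => m; rewrite -[RHS]/(mcoeff _ (fgscale _ _)) fgscaleE !mcoeffU.
  by rewrite mulrnAr mulr1.
by apply: scaleP; case: k => s; exact: wordP.
Qed.

(* \alpha(j): the terms i > j vanish as j < p^j. *)
Definition digit_sum (p j : nat) : nat := (\sum_(i < j.+1) (j %/ p ^ i) %% p)%N.

Lemma digit_sum_le (p j : nat) : (1 < p)%N -> (digit_sum p j <= j)%N.
Proof.
move=> p1; have expand k :
    j = (\sum_(i < k) (j %/ p ^ i) %% p * p ^ i + (j %/ p ^ k) * p ^ k)%N.
  elim: k => [|k IHk]; first by rewrite big_ord0 divn1 muln1.
  rewrite {1}IHk big_ord_recr /= -addnA; congr (_ + _)%N.
  by rewrite {1}(divn_eq (j %/ p ^ k) p) mulnDl addnC -divnMA -mulnA -!expnS expnSr.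
rewrite {2}(expand j.+1) (leq_trans _ (leq_addr _ _)) //.
by apply: leq_sum => i _; rewrite leq_pmulr // expn_gt0 (ltnW p1).
Qed.

(* The maximum defining l(n) is over the j < n; by [ell_max] this is
   no restriction. *)
Definition ell (p n : nat) : nat :=
  (\max_(j < n | p * j - digit_sum p j < (p - 1) * n) j)%N.

Lemma ell_max (p n : nat) : (1 < p)%N -> (0 < n)%N ->
  (p * ell p n - digit_sum p (ell p n) < (p - 1) * n)%N /\
  (forall j, (p * j - digit_sum p j < (p - 1) * n)%N -> (j <= ell p n)%N).
Proof.
move=> p1 n0; pose C j := (p * j - digit_sum p j < (p - 1) * n)%N.
split=> [|j Cj]; last first.
  have lt_jn : (j < n)%N.
    rewrite -(ltn_pmul2l (_ : 0 < p - 1)%N) ?subn_gt0 //.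
    apply: leq_ltn_trans Cj; rewrite mulnBl mul1n.
    by rewrite leq_sub2l // digit_sum_le.
  exact: (@leq_bigmax_cond _ (fun j : 'I_n => C j) _ (Ordinal lt_jn)).
rewrite -[is_true _]/(is_true (C (ell p n))) /ell.
have C0 : C 0%N by rewrite /C muln0 sub0n muln_gt0 subn_gt0 p1.
by elim/big_ind: _ => // x y Cx Cy; rewrite /maxn; case: ifP.
Qed.

Definition binz (x : int) (l : nat) : int :=
  ((\prod_(i < l) (x - i%:Z)) %/ l`!%:Z)%Z.

Lemma binzK (x : int) (l : nat) :
  binz x l * l`!%:Z = \prod_(i < l) (x - i%:Z).
Proof.
have natE (m k : nat) : \prod_(i < k) (m%:Z - i%:Z) = (m ^_ k)%:Z.
  elim: k => [|k IHk]; first by rewrite big_ord0.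
  rewrite big_ord_recr /= IHk ffactnSr PoszM.
  have [le_km|lt_mk] := leqP k m; first by rewrite subzn.
  by rewrite ffact_small // !mul0r.
have dvd : (l`!%:Z %| \prod_(i < l) (x - i%:Z))%Z; last by rewrite divzK.
case: x => m; first by rewrite natE -bin_ffact PoszM dvdz_mull.
have -> : \prod_(i < l) (Negz m - i%:Z) = (-1) ^+ l * ((m + l) ^_ l)%:Z.
  elim: l => [|l IHl]; first by rewrite big_ord0.
  rewrite big_ord_recr IHl addnS ffactSS PoszM exprS /= NegzE -addn1 -[(m + l).+1]addn1.
  by rewrite !PoszD; ring.
by rewrite -bin_ffact PoszM mulrA dvdz_mull.
Qed.

Definition binom_row (p n l : nat) (k : int) : 'rV['F_p]_n.+1 :=
  \row_(i < n.+1) (binz (k - i%:Z) l)%:~R.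

Section Bases.
Variables (R : pzRingType) (V : lmodType R) (I : finType).
Implicit Types (D : pred I) (b : I -> V).

Definition in_span D b (x : V) : Prop :=
  exists c : I -> R, x = \sum_(i | D i) c i *: b i.

(* The family (b i), i in D, is a basis of the subspace U; in particular its
   members are pairwise distinct. *)
Definition is_basis D b (U : V -> Prop) : Prop :=
  (forall c : I -> R,
     \sum_(i | D i) c i *: b i = 0 -> forall i, D i -> c i = 0) /\
  (forall x, U x <-> in_span D b x).
End Bases.

Definition Vspan (p n : nat) : reduced p -> Prop :=
  in_span predT (fun i : 'I_n.+1 => PchiP p n i).

(* Main.v *)
Require Import Defs.
From HB Require Import structures.
From mathcomp Require Import all_boot all_order all_algebra.
From mathcomp Require Import boolp monalg ring zify.

(** Write P(x) for the formal sum of the x^i P^i, so that chi P(x) = P(x)^-1,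
    and let f_n(x) = sum_i x^i P^i chi P^(n-i), the part of degree n of
    P(x) chi P(1).  The relations among the P^i chi P^(n-i) are described by the
    Taylor expansion of f_n at x = 1, whose coefficients are [taylor n r].

    The condition defining l(n) becomes simpler in terms of
    H(j) = sum_i floor(j / p^i): as p j - alpha(j) = (p - 1) H(j)
    ([floor_sum_digits]), j <= l(n) means H(j) < n ([leq_ell]).  The function H
    is superadditive.

    There are enough relations: f_n vanishes at x = 1 to order l(n) + 1
    ([taylor_eq0]).  In the form of Bullett and Macdonald the Adem relations
    read P(x) P(y) = P(x') P(y') whenever x + y = x' + y' and x^p y = x'^p y'
    ([total_P_relation]).  For (st, 1) and (s, t^p), with s = (1 - t)^(p-1),
    they give
      f_n(t^p) = s^n sum_j t^(n-j) chi P^j P^(n-j),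
    so that f_n(t^p) vanishes at t = 1 to order (p - 1) n, and to one order more
    because the sum vanishes at t = 1.  This kills the Taylor coefficients with
    p r <= (p - 1) n ([taylor_eq0_low]).  The others are reached by induction
    from the cocycle identity
      P(x) chi P(z) = (P(x) chi P(y)) (P(y) chi P(z)),
    which expresses binom(r + q, r) times the coefficient of index r + q through
    products of coefficients ([taylor_cocycle]); when H(r + q) < n each of these
    products has a factor that is already known to vanish, by superadditivity of
    H.  The indices r > 0 for which all binomial coefficients binom(r, q),
    0 < q < r, vanish mod p are the powers of p, and for r = p^k the condition
    H(r) < n is precisely p r <= (p - 1) n.

    There are no more relations: the reduced powers act on the space spanned by
    the monomials z_1^(p^k_1) ... z_N^(p^k_N), the total operation P(x) sending
    z to z + x z^p.  On a single variable
      P(x) chi P(1) z = z + sum_(k > 0) (-1)^k (1 - x)^(p^(k-1)) z^(p^k),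
    hence the coefficient in P(x) chi P(1) (z_1 ... z_N) of such a monomial, with
    all k_i > 0, is up to sign (1 - x)^e with e the sum of the p^(k_i - 1), and
    its degree n is the sum of the (p^k_i - 1) / (p - 1).  Every e with
    e <= n <= H(e) occurs ([exists_powers]), that is, every e from l(n) + 1 to n.
    So a relation v is orthogonal to the coefficient vectors of the polynomials (1 - x)^e
    ([relation_orthogonal]), and this triangular system determines v by its
    entries of index at most l(n) ([relation_eq0]).

    The rest is linear algebra: the binomial vectors are combinations of Taylor
    coefficients ([binz_Newton]), any l + 1 consecutive ones are linearly
    independent ([binz_window_free]), and the Taylor relations rewrite the
    P^i chi P^(n-i) with i <= l(n) in terms of those with i > l(n). *)

Set Implicit Arguments.
Unset Strict Implicit.
Unset Printing Implicit Defensive.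

Import Order.TTheory GRing.Theory Num.Theory.

Local Open Scope ring_scope.

(** * Binomial coefficients modulo p *)

(** Mod p and up to sign, this is the coefficient of t^d in
    (1 - t)^(-(p-1)d - 1), that is binom(pd, d), a multiple of p; the term
    p^(K+1) replaces the negative exponent by a natural one without changing the
    low coefficients mod p. *)
Lemma prime_dvd_bin_ppow p K d : prime p -> (0 < d < p ^ K)%N ->
  (p %| 'C(p ^ K.+1 - ((p - 1) * d).+1, d))%N.
Proof.
move=> p_pr; case: d => // d /andP[_ dK].
have p_gt0 := prime_gt0 p_pr.
have := mul_bin_left (p ^ K.+1 - ((p - 1) * d.+1).+1) d.
have -> : (p ^ K.+1 - ((p - 1) * d.+1).+1 - d = p * (p ^ K - d.+1))%N.
  rewrite expnS mulnBr mulnBl mul1n.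
  have : (d.+1 <= p * d.+1)%N by rewrite leq_pmull.
  have : (p * d.+1 <= p * p ^ K)%N by rewrite leq_mul2l (ltnW dK) orbT.
  lia.
set C := 'C(_, d.+1); set B := 'C(_, d) => eqC.
(* In d C = p (p^K - d) B the right-hand side has larger p-adic valuation than
   d, because d < p^K. *)
have vK : (logn p d.+1 <= K)%N.
  rewrite -(@leq_exp2l p) ?prime_gt1 // (leq_trans _ (ltnW dK)) //.
  by rewrite dvdn_leq // pfactor_dvdnn.
have dvd : (p ^ (logn p d.+1).+1 %| d.+1 * C)%N.
  rewrite eqC -mulnA expnS dvdn_pmul2l //; apply: dvdn_mulr.
  by apply: dvdn_sub; [apply: dvdn_exp2l | apply: pfactor_dvdnn].
have [C0|C_gt0] := posnP C; first by rewrite C0.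
apply: contraLR dvd => pC.
by rewrite pfactor_dvdn ?muln_gt0 ?C_gt0 // lognM // (logn_coprime (p := p) (m := C))
  ?addn0 ?ltnn // prime_coprime.
Qed.

Lemma coef_1addZX_exp (R : comNzRingType) (c : R) m k :
  ((1 + c *: 'X) ^+ m)`_k = c ^+ k * 'C(m, k)%:R.
Proof.
rewrite exprDn coef_sum.
under eq_bigr => i _ do rewrite expr1n mul1r exprZn coefMn coefZ coefXn.
have [km|mk] := ltnP k m.+1; last first.
  rewrite bin_small // mulr0 big1 // => i _.
  by rewrite gtn_eqF ?mulr0 ?mul0rn // (leq_trans (ltn_ord i)).
rewrite (bigD1 (Ordinal km)) //= big1 ?addr0 => [|i /negPf ik].
  by rewrite eqxx mulr1 mulr_natr.
by rewrite eq_sym -[k]/(val (Ordinal km)) val_eqE ik mulr0 mul0rn.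
Qed.

Lemma coef_1addX_exp (R : comNzRingType) m k :
  ((1 + 'X : {poly R}) ^+ m)`_k = 'C(m, k)%:R.
Proof. by rewrite -['X in LHS]scale1r coef_1addZX_exp expr1n mul1r. Qed.

Lemma coef_1subX_exp (R : comNzRingType) m k :
  ((1 - 'X : {poly R}) ^+ m)`_k = (-1) ^+ k * 'C(m, k)%:R.
Proof. by rewrite -scaleN1r coef_1addZX_exp. Qed.

Lemma coef_1addXn_exp (R : comNzRingType) (n m i : nat) : (0 < n)%N ->
  ((1 + 'X^n : {poly R}) ^+ m)`_(n * i) = 'C(m, i)%:R.
Proof.
move=> n_gt0; have -> : (1 + 'X^n) ^+ m = (1 + 'X) ^+ m \Po 'X^n :> {poly R}.
  by rewrite rmorphXn rmorphD /= comp_polyX rmorph1.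
by rewrite coef_comp_poly_Xn // dvdn_mulr // mulKn // coef_1addX_exp.
Qed.

(** * The Bullett-Macdonald form of the Adem relations *)

Section BullettMacdonald.
Variables (p : nat) (R : comNzRingType) (charR : p \in [pchar R]).
Implicit Types (G : nat -> R) (x y : {poly R}).
Let p_pr : prime p := pcharf_prime charR.
Local Notation s := ((1 - 'X : {poly R}) ^+ (p - 1)).

Lemma exprD_ppow x y k : (x + y) ^+ (p ^ k) = x ^+ (p ^ k) + y ^+ (p ^ k).
Proof. by apply: exprDn_pchar; rewrite pnatX pnatE // pchar_poly charR. Qed.

Lemma exprN1_ppow k : (- 1) ^+ (p ^ k) = - 1 :> {poly R}.
Proof.
apply/eqP; rewrite -addr_eq0 -[X in _ + X](expr1n _ (p ^ k)) -exprD_ppow addNr.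
by rewrite expr0n expn_eq0 (gtn_eqF (prime_gt0 p_pr)).
Qed.

Lemma exprB_ppow x y k : (x - y) ^+ (p ^ k) = x ^+ (p ^ k) - y ^+ (p ^ k).
Proof. by rewrite exprD_ppow exprNn exprN1_ppow mulN1r. Qed.

Lemma bin_ppow k m i : 'C(p ^ k * m, p ^ k * i)%:R = 'C(m, i)%:R :> R.
Proof.
rewrite -coef_1addX_exp exprM exprD_ppow expr1n coef_1addXn_exp //.
by rewrite expn_gt0 prime_gt0.
Qed.

(** With s = (1 - t)^(p-1), the pairs (s, t^p) and (st, 1) have the same sum;
    they also have the same x^p y, namely s^p t^p. *)
Lemma addsX : s + 'X ^+ p = 1 + 'X * s.
Proof.
have e : (1 - 'X) * s = 1 - 'X ^+ p.
  rewrite -exprS subn1 prednK ?prime_gt0 //.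
  by have := exprB_ppow 1 'X 1; rewrite expn1 expr1n.
have -> : 'X ^+ p = 1 - (1 - 'X) * s by rewrite e subKr.
by move: s => t; ring.
Qed.

(** Here G m stands for P^m P^(n-m): this is the part of degree n of
    P(s) P(t^p) = P(st) P(1), where s = (1 - t)^(p-1). *)
Definition bullett_macdonald n G : Prop :=
  \sum_(m < n.+1) G m *: (s ^+ m * ('X ^+ p) ^+ (n - m)) =
  \sum_(m < n.+1) G m *: ('X * s) ^+ m.

(** The Adem relation for P^a P^b is the coefficient of u^a in the
    Bullett-Macdonald relation written in the variable u = st, and
    du = (1 - t)^(p-2) dt.  As a residue, it is the coefficient of t^a after
    multiplication by (1 - t)^(-(p-1)a - 1), a negative power which the factor E
    below imitates modulo t^(p^(a+2)). *)
Lemma bullett_macdonald_Adem n G a b :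
    bullett_macdonald n G -> (a + b)%N = n -> (a < p * b)%N ->
  G a = \sum_(j < a.+1 | (p * j <= a)%N)
          (-1) ^+ (a + j) * 'C((p - 1) * (b - j) - 1, a - p * j)%:R * G (a + b - j)%N.
Proof.
move=> bm abn apb; have p_gt0 := prime_gt0 p_pr.
have p1 := prime_gt1 p_pr.
pose M := (p ^ a.+2)%N.
have aM : (a < p ^ a.+1)%N by rewrite (leq_trans _ (ltnW (ltn_expl a.+1 p1))).
have MaM : (p * a.+1 <= M)%N by rewrite /M expnS leq_mul2l aM orbT.
pose E := (1 - 'X : {poly R}) ^+ (M - ((p - 1) * a).+1).
have hM : (((p - 1) * a).+1 <= M)%N.
  by apply: leq_trans MaM; rewrite mulnS mulnBl mul1n; lia.
have := congr1 (fun f => (E * f)`_a) bm; rewrite !mulr_sumr !coef_sum.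
have an : (a < n.+1)%N by rewrite -abn ltnS leq_addr.
(* On the right only the term m = a survives, by [prime_dvd_bin_ppow]. *)
rewrite [X in _ = X](bigD1 (Ordinal an)) //= [X in _ = _ + X]big1 => [|i ia]; last first.
  rewrite -scalerAr exprMn_comm; last exact: mulrC.
  rewrite mulrCA coefZ coefXnM; case: ltnP => [_|i_le]; first by rewrite mulr0.
  have {}ia : (i < a)%N by rewrite ltn_neqAle i_le andbT.
  rewrite /E -exprM -exprD coef_1subX_exp.
  have -> : (M - ((p - 1) * a).+1 + (p - 1) * i = M - ((p - 1) * (a - i)).+1)%N.
    rewrite mulnBr; have: ((p - 1) * i <= (p - 1) * a)%N by rewrite leq_mul2l i_le orbT.
    by move: hM; lia.
  suff: (p %| 'C(M - ((p - 1) * (a - i)).+1, a - i))%N.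
    by rewrite (dvdn_pcharf charR) => /eqP ->; rewrite !mulr0.
  by apply: prime_dvd_bin_ppow => //; rewrite subn_gt0 ia (leq_ltn_trans (leq_subr _ _) aM).
rewrite addr0 -scalerAr exprMn_comm; last exact: mulrC.
rewrite mulrCA coefZ coefXnM ltnn subnn /E -exprM -exprD coef_1subX_exp.
rewrite expr0 bin0 !mulr1 => <-.
(* On the left the term m = n - j contributes the Adem coefficient. *)
rewrite (reindex_inj rev_ord_inj) /= (big_ord_widen_cond n.+1 (fun j => (p * j <= a)%N)
  (fun j => (-1) ^+ (a + j) * 'C((p - 1) * (b - j) - 1, a - p * j)%:R * G (a + b - j)%N)) //.
rewrite big_mkcond /= [RHS]big_mkcond; apply: eq_bigr => j _.
have jn : (j <= n)%N by rewrite -ltnS.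
rewrite subSS subKn // -scalerAr coefZ mulrA -exprM -exprD -exprM coefMXn.
have [paj|pja] := ltnP a (p * j); rewrite ?mulr0 //=.
have ja : (j < a.+1)%N by rewrite ltnS (leq_trans _ pja) // leq_pmull.
have jb : (j < b)%N by rewrite -(ltn_pmul2l p_gt0) (leq_ltn_trans pja).
rewrite ja /= mulrC abn; congr (_ * _).
have -> : (M - ((p - 1) * a).+1 + (p - 1) * (n - j) = M + ((p - 1) * (b - j) - 1))%N.
  have -> : ((p - 1) * (n - j) = (p - 1) * a + (p - 1) * (b - j))%N.
    by rewrite -mulnDr addnBA ?(ltnW jb) // abn.
  have : (0 < (p - 1) * (b - j))%N by rewrite muln_gt0 !subn_gt0 p1 jb.
  by move: hM; lia.
rewrite exprD /M exprB_ppow expr1n mulrBl mul1r coefB coefXnM.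
rewrite (leq_ltn_trans (leq_subr _ _)) ?subr0 ?coef_1subX_exp; last first.
  by rewrite (leq_trans aM) // leq_exp2l.
congr (_ * _); have N1p : (-1) ^+ (p * j) = (-1) ^+ j :> R.
  rewrite exprM; congr (_ ^+ j); apply: polyC_inj.
  by have := exprN1_ppow 1; rewrite expn1 -(rmorphN1 polyC) -rmorphXn.
have := signrMK (p * j) ((-1) ^+ (a - p * j) : R).
by rewrite -exprD subnKC // N1p => <-; rewrite -exprD addnC.
Qed.
End BullettMacdonald.

(** * Quadratic relations *)

Section Homogenization.
Variables (R : comNzRingType) (x y : {poly R}).
Implicit Types f : {poly R}.

Definition homogenize n f : {poly R} :=
  \sum_(m < n.+1) f`_m *: (x ^+ m * y ^+ (n - m)).

Lemma homogenizeD n f g : homogenize n (f + g) = homogenize n f + homogenize n g.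
Proof. by rewrite -big_split; apply: eq_bigr => m _; rewrite coefD scalerDl. Qed.

Lemma homogenize_mulX n f : homogenize n.+1 (f * 'X) = x * homogenize n f.
Proof.
rewrite /homogenize big_ord_recl coefMX /= scale0r add0r mulr_sumr.
apply: eq_bigr => m _; rewrite coefMX /= subSS -scalerAr exprS.
by rewrite mulrA.
Qed.

Lemma homogenizeS n f : (size f <= n.+1)%N -> homogenize n.+1 f = y * homogenize n f.
Proof.
move=> sf; rewrite /homogenize big_ord_recr /= nth_default // scale0r addr0 mulr_sumr.
apply: eq_bigr => m _; rewrite subSn; last by rewrite -ltnS.
by rewrite -scalerAr exprS mulrCA.
Qed.

Lemma size_1addX_exp (a b : nat) :
  (size ((1 + 'X) ^+ a * 'X^b : {poly R})%R <= (a + b).+1)%N.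
Proof.
rewrite (leq_trans (size_polyMleq _ _)) // size_polyXn addnS /= -addSn leq_add2r.
have s2 : size (1 + 'X : {poly R}) = 2%N by rewrite addrC -polyC1 size_XaddC.
elim: a => [|a IHa]; first by rewrite expr0 size_poly1.
rewrite exprS (leq_trans (size_polyMleq _ _)) // s2 add2n.
by rewrite ltnS.
Qed.

Lemma homogenize_1addX (a b c : nat) :
  homogenize (a + b + c) ((1 + 'X) ^+ a * 'X^b) = (x + y) ^+ a * x ^+ b * y ^+ c.
Proof.
elim: c => [|c IHc]; last first.
  rewrite addnS homogenizeS ?IHc; last first.
    by rewrite (leq_trans (size_1addX_exp _ _)) // ltnS leq_addr.
  by rewrite exprS mulrCA.
rewrite addn0 mulr1; elim: b => [|b IHb]; last first.
  by rewrite addnS exprSr mulrA homogenize_mulX IHb mulrC -mulrA -exprSr.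
rewrite addn0 mulr1 expr0 mulr1; elim: a => [|a IHa].
  by rewrite /homogenize big_ord1 expr0 coef1 scale1r mulr1.
rewrite !exprSr mulrDr mulr1 homogenizeD homogenize_mulX homogenizeS ?IHa.
  by rewrite -mulrDl mulrC [y + x]addrC.
by have := size_1addX_exp a 0; rewrite addn0 expr0 mulr1.
Qed.
End Homogenization.

(** The coefficient of x^m y^(n-m) in (x + y)^(n-(p+1)r) (x^p y)^r, see
    [quad_coef_sum].  These polynomials are the matrix coefficients of P(x) P(y)
    on monomials with p-power exponents, as in one variable
    P(x) P(y) z = z + (x + y) z^p + x^p y z^(p^2). *)
Definition quad_coef (p n r m : nat) : 'F_p :=
  ((1 + 'X) ^+ (n - p.+1 * r) * 'X^(p * r) : {poly 'F_p})`_m.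

Section Quadratic.
Variables (p : nat) (p_pr : prime p).
Local Notation F := 'F_p.

Lemma quad_coef_sum n r (x y : {poly F}) : (p.+1 * r <= n)%N ->
  \sum_(m < n.+1) quad_coef p n r m *: (x ^+ m * y ^+ (n - m)) =
  (x + y) ^+ (n - p.+1 * r) * (x ^+ p * y) ^+ r.
Proof.
move=> rn; rewrite exprMn -exprM mulrA -homogenize_1addX /homogenize.
by rewrite (_ : (_ + r = n)%N) // -addnA [(p * r + r)%N]addnC -mulSn subnK.
Qed.

Lemma quad_coef_bullett_macdonald n r :
  (p.+1 * r <= n)%N -> bullett_macdonald p n (quad_coef p n r).
Proof.
move=> rn; rewrite /bullett_macdonald quad_coef_sum // (addsX (pchar_Fp p_pr)).
have := quad_coef_sum ('X * (1 - 'X) ^+ (p - 1)) 1 rn.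
under eq_bigr => m _ do rewrite expr1n mulr1.
move=> ->; rewrite mulr1; congr (_ ^+ _ * _ ^+ _); first exact: addrC.
by rewrite exprMn mulrC.
Qed.

Lemma quad_coef_gt n r m : (p.+1 * r <= n)%N -> (n - r < m)%N -> quad_coef p n r m = 0.
Proof.
move=> rn nm; rewrite /quad_coef nth_default // (leq_trans (size_1addX_exp _ _ _)) //.
by rewrite (leq_trans _ nm) // ltnS mulSn; lia.
Qed.

Lemma quad_coef_lead n r : (p.+1 * r <= n)%N -> quad_coef p n r (n - r) = 1.
Proof.
move=> rn; rewrite /quad_coef coefMXn ltnNge.
have -> : (p * r <= n - r)%N by move: rn; rewrite mulSn; lia.
by rewrite -subnDA -mulSn coef_1addX_exp binn.
Qed.

(** The Adem relation for P^k P^(n-k) as a vector of coefficients, the m-th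
    being that of P^m P^(n-m). *)
Definition Adem_row n k (m : nat) : F :=
  (m == k)%:R - \sum_(j < k.+1 | (p * j <= k)%N)
     signed_bin p (k + j) ((p - 1) * (n - k - j) - 1) (k - p * j) * (m == n - j)%N%:R.

Lemma Adem_row_sum (V : lmodType F) n k (Z : nat -> V) : (k < p * (n - k))%N ->
  \sum_(m < n.+1) Adem_row n k m *: Z m = Z k - \sum_(j < k.+1 | (p * j <= k)%N)
     signed_bin p (k + j) ((p - 1) * (n - k - j) - 1) (k - p * j) *: Z (n - j)%N.
Proof.
move=> kn; have kn1 : (k < n.+1)%N.
  by rewrite ltnS ltnW // -subn_gt0; case: (n - k)%N kn => //; rewrite muln0.
have pick i : (i < n.+1)%N -> \sum_(m < n.+1) (m == i :> nat)%:R *: Z m = Z i.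
  move=> ni; rewrite (bigD1 (Ordinal ni)) //= eqxx scale1r big1 ?addr0 // => m.
  by rewrite -val_eqE /= => /negPf ->; rewrite scale0r.
under eq_bigr do rewrite scalerBl; rewrite sumrB pick //; congr (_ - _).
under eq_bigr do rewrite scaler_suml; rewrite exchange_big /=.
apply: eq_bigr => j _; under eq_bigr do rewrite -scalerA.
by rewrite -scaler_sumr pick // ltnS leq_subr.
Qed.

(** The other terms of the relation lie in positions n - j > k: this is why
    Adem reduction terminates. *)
Lemma Adem_row_support n k m : (k < p * (n - k))%N -> (m <= k)%N ->
  Adem_row n k m = (m == k)%:R.
Proof.
move=> kn mk; rewrite /Adem_row big1 ?subr0 // => j pj.
suff /ltn_eqF -> : (m < n - j)%N by rewrite mulr0.
have: (p * j < p * (n - k))%N by apply: leq_ltn_trans pj kn.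
by rewrite ltn_pmul2l ?prime_gt0 //; lia.
Qed.

Lemma Adem_row_quad_coef n k r : (k < p * (n - k))%N -> (p.+1 * r <= n)%N ->
  \sum_(m < n.+1) Adem_row n k m * quad_coef p n r m = 0.
Proof.
move=> kn rn; rewrite (@Adem_row_sum F^o) //; apply/eqP; rewrite subr_eq0; apply/eqP.
have e : (k + (n - k))%N = n.
  by rewrite subnKC // ltnW // -subn_gt0; case: (n - k)%N kn => //; rewrite muln0.
by rewrite (bullett_macdonald_Adem (pchar_Fp p_pr) (quad_coef_bullett_macdonald rn) e kn) e.
Qed.

End Quadratic.

Arguments Adem_row p n k m : clear implicits.

(** Stated for a sequence in an arbitrary algebra because it serves both the
    reduced powers and the matrices representing them. *)
Definition Adem_relations p (A : algType 'F_p) (P : nat -> A) : Prop :=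
  forall a b, (0 < a < p * b)%N ->
  P a * P b = \sum_(j < a.+1 | (p * j <= a)%N)
     signed_bin p (a + j) ((p - 1) * (b - j) - 1) (a - p * j)
       *: (P (a + b - j)%N * P j).

Section AdemSequences.
Variables (p : nat) (p_pr : prime p) (A : algType 'F_p) (P : nat -> A).
Local Notation F := 'F_p.
Hypothesis P_Adem : Adem_relations P.
Hypothesis P0 : P 0 = 1.

Lemma Adem_row_relation n k : (k < p * (n - k))%N ->
  \sum_(m < n.+1) Adem_row p n k m *: (P m * P (n - m)) = 0.
Proof.
move=> kn; rewrite (Adem_row_sum (fun m => P m * P (n - m)%N)) //.
have e : (k + (n - k))%N = n.
  by rewrite subnKC // ltnW // -subn_gt0; case: (n - k)%N kn => //; rewrite muln0.
have jn j : (p * j <= k)%N -> (j <= n)%N.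
  move=> pj; have: (p * j < p * (n - k))%N by apply: leq_ltn_trans pj kn.
  by rewrite ltn_pmul2l ?prime_gt0 //; lia.
have [k0|k_gt0] := posnP k.
  rewrite k0 in kn *; rewrite (bigD1 ord0) ?muln0 //= big1 ?addr0 => [|j].
    by rewrite !(subn0, subnn, sub0n, addn0, muln0) /signed_bin bin0 P0 expr0
      !(mulr1, mul1r) scale1r subrr.
  by case: j => -[|j] //= ?; rewrite andbF.
rewrite (@P_Adem k (n - k)%N) ?k_gt0 // e; apply/eqP; rewrite subr_eq0; apply/eqP.
by apply: eq_bigr => j /jn jn'; rewrite subKn.
Qed.

(** The Adem relations imply every quadratic relation that holds on monomials.
    Adem reduction brings v to the admissible positions m >= p (n - m); there
    the vectors [quad_coef p n r] form a triangular system, so that what is left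
    of v is zero. *)
Lemma quadratic_relation n (v : nat -> F) :
  (forall r, (p.+1 * r <= n)%N -> \sum_(m < n.+1) v m * quad_coef p n r m = 0) ->
  \sum_(m < n.+1) v m *: (P m * P (n - m)) = 0.
Proof.
suff S i k w : (i + k = n.+1)%N ->
    (forall m, (m < k)%N -> (m < p * (n - m))%N -> w m = 0) ->
    (forall r, (p.+1 * r <= n)%N -> \sum_(m < n.+1) w m * quad_coef p n r m = 0) ->
    \sum_(m < n.+1) w m *: (P m * P (n - m)) = 0.
  by apply: (S n.+1 0%N); rewrite ?addn0.
elim: i k w => [|i IHi] k w.
  rewrite add0n => -> w0 orth.
  (* The last nonzero entry of [quad_coef p n r] is a 1 in position n - r, so the
     admissible entries of w vanish one after the other, from the lowest
     position upwards. *)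
  have w_adm i r : (r + i = n)%N -> (p.+1 * r <= n)%N -> w (n - r)%N = 0.
    elim/ltn_ind: i r => i IHi r ri rn.
    have nr : (n - r < n.+1)%N by rewrite ltnS leq_subr.
    have := orth r rn; rewrite (bigD1 (Ordinal nr)) //= quad_coef_lead // mulr1.
    rewrite big1 ?addr0 // => m; rewrite -val_eqE /= => mr.
    have mn : (m <= n)%N by rewrite -ltnS.
    have [m_in|m_adm] := ltnP m (p * (n - m)); first by rewrite w0 ?mul0r.
    have [lt|ge] := ltnP (n - r) m; first by rewrite quad_coef_gt ?mulr0.
    suff -> : w m = 0 by rewrite mul0r.
    rewrite -[in w _](subKn mn); apply: (IHi m); rewrite ?subnK ?mulSn //; lia.
  apply: big1 => m _; have mn : (m <= n)%N by rewrite -ltnS.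
  have [m_in|m_adm] := ltnP m (p * (n - m)); first by rewrite w0 ?scale0r.
  suff -> : w m = 0 by rewrite scale0r.
  by rewrite -[in w _](subKn mn); apply: (w_adm m); rewrite ?subnK ?mulSn //; lia.
rewrite addSnnS => ik w0 orth.
have [kin|kadm] := ltnP k (p * (n - k)); last first.
  apply: (IHi k.+1) => // m; rewrite ltnS leq_eqVlt => /orP[/eqP ->|]; last exact: w0.
  by rewrite ltnNge kadm.
(* k is an inadmissible position: one step of Adem reduction. *)
pose w' m := w m - w k * Adem_row p n k m.
have := IHi k.+1 w' ik.
under [X in _ -> _ -> X = _]eq_bigr do rewrite scalerBl -scalerA.
rewrite sumrB -scaler_sumr Adem_row_relation // scaler0 subr0; apply.
  move=> m; rewrite ltnS => mk mn; rewrite /w' Adem_row_support //.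
  case: ltngtP mk => // [mk|->] _; last by rewrite mulr1 subrr.
  by rewrite mulr0 subr0 w0.
move=> r rn; under eq_bigr do rewrite mulrBl -mulrA.
by rewrite sumrB -mulr_sumr Adem_row_quad_coef // mulr0 subr0 orth.
Qed.
End AdemSequences.

(** * The Taylor coefficients of P(x) chi P(1) at x = 1 *)

Lemma toS_scaleM p c (x y : freeAlg p) :
  toS (c *: (x * y)) = c *: (toS x * toS y).
Proof.
have -> : toS x * toS y = toS (x * y) by rewrite [RHS](rmorphM (@toS p)).
exact: (toSZ c).
Qed.

Lemma Adem_relation p : Adem_relations (Pow p).
Proof.
move=> a b ab; apply: val_inj; have /toS_eqP e := Ideal_relator (Rel_Adem ab).
apply: etrans (esym (toSM _ _)) (etrans e _); rewrite !raddf_sum /=.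
by apply: eq_bigr => j _; apply: toS_scaleM.
Qed.

Lemma bin_trinomial i r q :
  ('C(r + q, r) * 'C(i, r + q) = 'C(i, r) * 'C(i - r, q))%N.
Proof.
have [rqi|irq] := leqP (r + q) i; last first.
  rewrite (bin_small irq) muln0; have [ri|ir] := leqP r i; last by rewrite bin_small.
  by rewrite (@bin_small (i - r)) ?muln0 // ltn_subLR.
have f1 := bin_fact rqi; have f2 := bin_fact (leq_addr q r).
have f3 := @bin_fact i r; have f4 := @bin_fact (i - r) q.
move: f2 (f3 ltac:(lia)) (f4 ltac:(lia)).
rewrite addKn => f2 f3' f4'; apply/eqP.
rewrite -(@eqn_pmul2r (r`! * (q`! * (i - r - q)`!))) ?muln_gt0 ?fact_gt0 //.
apply/eqP; transitivity i`!.
  by rewrite -f1 -f2 subnDA; ring.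
by rewrite -f3' -f4'; ring.
Qed.

(** Graded series with coefficients in a ring, such as the total operations, are
    represented by the sequence of their homogeneous parts; their product is the
    convolution. *)
Section Convolution.
Variable R : nzRingType.
Implicit Types f g h : nat -> R.

Definition conv f g n : R := \sum_(i < n.+1) f i * g (n - i)%N.
Definition delta n : R := (n == 0%N)%:R.

Lemma conv_coef N f g n : (n <= N)%N ->
  conv f g n = (\poly_(i < N.+1) f i * \poly_(i < N.+1) g i)`_n.
Proof.
move=> nN; rewrite coefM; apply: eq_bigr => i _; rewrite !coef_poly.
have iN : (i <= N)%N by rewrite (leq_trans _ nN) // -ltnS.
by rewrite !ltnS iN (leq_trans (leq_subr _ _) nN).
Qed.

Lemma convA f g h : conv f (conv g h) = conv (conv f g) h.
Proof.
apply: funext => n; pose q u : {poly R} := \poly_(i < n.+1) u i.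
transitivity ((q f * (q g * q h))`_n).
  rewrite coefM; apply: eq_bigr => i _.
  by rewrite coef_poly ltn_ord -conv_coef ?leq_subr.
rewrite mulrA coefM; apply: eq_bigr => i _.
by rewrite coef_poly ltnS leq_subr -conv_coef // -ltnS.
Qed.

Lemma conv1l f : conv delta f = f.
Proof.
apply: funext => n; rewrite /conv big_ord_recl /= mul1r subn0 big1 ?addr0 // => i _.
by rewrite mul0r.
Qed.

Lemma conv1r f : conv f delta = f.
Proof.
apply: funext => n; rewrite /conv big_ord_recr /= subnn mulr1 big1 ?add0r // => i _.
by rewrite /delta subn_eq0 leqNgt ltn_ord mulr0.
Qed.

Lemma conv_left_inj f : f 0%N = 1 -> injective (conv f).
Proof.
move=> f0 g h e; apply: funext; elim/ltn_ind => n IHn.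
have := congr1 (fun w => w n) e; rewrite /conv !big_ord_recl /= f0 !mul1r subn0.
have -> : \sum_(i < n) f (bump 0 i) * g (n - bump 0 i)%N =
          \sum_(i < n) f (bump 0 i) * h (n - bump 0 i)%N.
  apply: eq_bigr => i _; rewrite IHn // /bump /= add1n.
  by case: n i {IHn} => [[]//|n] i; rewrite subSS ltnS leq_subr.
exact: addIr.
Qed.

Lemma conv_inv_comm f g : f 0%N = 1 -> conv f g = delta -> conv g f = delta.
Proof.
by move=> f0 fg; apply: (conv_left_inj f0); rewrite convA fg conv1l conv1r.
Qed.

Lemma conv_exchange f g f' g' fV gV : conv f g = conv f' g' ->
  conv fV f = @delta -> conv g' gV = @delta -> conv g gV = conv fV f'.
Proof.
move=> e fVf ggV.
by rewrite -[LHS]conv1l -fVf -convA (convA f) e -(convA f') ggV conv1r.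
Qed.
End Convolution.

Section TotalPowers.
Variables (p : nat) (p_pr : prime p) (A : algType 'F_p) (P Q : nat -> A).
Local Notation F := 'F_p.
Implicit Types (x y : {poly F}) (f g : nat -> A).
Hypothesis P_Adem : Adem_relations P.
Hypothesis P0 : P 0 = 1.
Hypothesis conv_PQ : conv P Q = @delta A.

Local Notation polyA := (map_poly (in_alg A)).

Lemma polyA_comm x (a : A) : a%:P * polyA x = polyA x * a%:P.
Proof.
apply/polyP => i; rewrite coefCM coefMC !coef_map /=.
by rewrite -scalerAl mul1r -scalerAr mulr1.
Qed.

Lemma coef_polyAM x (a : A) i : (polyA x * a%:P)`_i = x`_i *: a.
Proof. by rewrite coefMC coef_map /= -scalerAl mul1r. Qed.

(** The sequence of the w_m f_m, with polynomial weights w_m; coefficients of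
    weights and elements of A commute in {poly A}. *)
Definition weighted (w : nat -> {poly F}) f m : {poly A} := polyA (w m) * (f m)%:P.

Lemma weightedM (u w : nat -> {poly F}) f g m k :
  weighted u f m * weighted w g k = polyA (u m * w k) * (f m * g k)%:P.
Proof.
rewrite /weighted rmorphM polyCM /= -!mulrA; congr (_ * _).
by rewrite !mulrA polyA_comm.
Qed.

(** For f = P this is the total operation P(x). *)
Definition total x f := weighted (fun m => x ^+ m) f.

Lemma totalM x y f g m k :
  total x f m * total y g k = polyA (x ^+ m * y ^+ k) * (f m * g k)%:P.
Proof. exact: weightedM. Qed.

Lemma conv_total x f g : conv (total x f) (total x g) = total x (conv f g).
Proof.
apply: funext => n; rewrite /total /weighted raddf_sum mulr_sumr /=; apply: eq_bigr => i _.
by rewrite weightedM -exprD subnKC -1?ltnS.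
Qed.

Lemma coef_conv_total x y f g n i :
  (conv (total x f) (total y g) n)`_i =
  \sum_(m < n.+1) (x ^+ m * y ^+ (n - m))`_i *: (f m * g (n - m)%N).
Proof. by rewrite /conv coef_sum; apply: eq_bigr => m _; rewrite totalM coef_polyAM. Qed.

Lemma total_delta x : total x (@delta A) = @delta _.
Proof.
apply: funext => -[|n]; rewrite /total /weighted /delta /=; first by rewrite expr0 rmorph1 mul1r.
by rewrite mulr0.
Qed.

Lemma conv_QP : conv Q P = @delta _.
Proof. exact: conv_inv_comm P0 conv_PQ. Qed.

(** Both sides have the same pairing with the monomials of
    [quad_coef_sum], which are polynomials in x + y and x^p y. *)
Lemma total_P_relation x y x' y' : x + y = x' + y' -> x ^+ p * y = x' ^+ p * y' ->
  conv (total x P) (total y P) = conv (total x' P) (total y' P).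
Proof.
move=> eD eM; apply: funext => n; apply/polyP => q; apply/eqP; rewrite -subr_eq0.
rewrite !coef_conv_total -sumrB; under eq_bigr do rewrite -scalerBl; apply/eqP.
apply: (@quadratic_relation p p_pr A P P_Adem P0 n
  (fun m => (x ^+ m * y ^+ (n - m))`_q - (x' ^+ m * y' ^+ (n - m))`_q)) => r rn.
under eq_bigr do rewrite mulrC mulrBr -!coefZ.
by rewrite sumrB -!coef_sum !quad_coef_sum // eD eM subrr.
Qed.

(** Multiply P(x) P(y) = P(x') P(y') by P(x)^-1 on the left and by P(y')^-1 on
    the right. *)
Lemma total_PQ x y x' y' : x + y = x' + y' -> x ^+ p * y = x' ^+ p * y' ->
  conv (total y P) (total y' Q) = conv (total x Q) (total x' P).
Proof.
move=> eD eM; apply: (conv_exchange (total_P_relation eD eM)).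
  by rewrite conv_total conv_QP total_delta.
by rewrite conv_total conv_PQ total_delta.
Qed.

Lemma total_PQ_coef x y x' y' n i :
    x + y = x' + y' -> x ^+ p * y = x' ^+ p * y' ->
  \sum_(m < n.+1) (y ^+ m * y' ^+ (n - m))`_i *: (P m * Q (n - m)) =
  \sum_(m < n.+1) (x ^+ m * x' ^+ (n - m))`_i *: (Q m * P (n - m)).
Proof.
move=> eD eM; apply: etrans (esym (coef_conv_total _ _ _ _ _ _)) _.
by apply: etrans (coef_conv_total _ _ _ _ _ _); rewrite (total_PQ eD eM).
Qed.

(** The coefficient of (x - 1)^r in sum_i x^i P^i Q^(n-i). *)
Definition taylor n r : A := \sum_(i < n.+1) 'C(i, r)%:R *: (P i * Q (n - i)%N).

(** Take t = 1 + w, where w is the polynomial variable.  Then s = w^(p-1), so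
    that sum_r [taylor n r] w^(pr) = s^n sum_j t^(n-j) Q^j P^(n-j) is divisible
    by w^((p-1)n); the sum on the right has constant term sum_j Q^j P^(n-j),
    which is 0 for n > 0. *)
Lemma taylor_eq0_low n r : (0 < n)%N -> (p * r <= (p - 1) * n)%N -> taylor n r = 0.
Proof.
move=> n_gt0 rn; have p_gt0 := prime_gt0 p_pr.
pose s : {poly F} := 'X ^+ (p - 1); pose t : {poly F} := 1 + 'X.
have tp : t ^+ p = 1 + 'X^p.
  by have := exprD_ppow (pchar_Fp p_pr) 1 'X 1; rewrite expn1 expr1n.
have eD : s + t ^+ p = t * s + 1.
  rewrite tp /t mulrDl mul1r /s -exprS subn1 prednK //; ring.
have eM : s ^+ p * t ^+ p = (t * s) ^+ p * 1 by rewrite mulr1 exprMn mulrC.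
have e := total_PQ_coef n (p * r) eD eM.
transitivity (
  \sum_(m < n.+1) ((t ^+ p) ^+ m * 1 ^+ (n - m))`_(p * r) *: (P m * Q (n - m)%N)).
  apply: eq_bigr => m _; congr (_ *: _).
  by rewrite expr1n mulr1 tp coef_1addXn_exp.
rewrite {}e.
transitivity (\sum_(m < n.+1) (if (p * r < (p - 1) * n)%N then 0 else
    (t ^+ (n - m))`_0) *: (Q m * P (n - m))).
  apply: eq_bigr => m _; congr (_ *: _).
  rewrite exprMn mulrCA -exprD subnKC; last by rewrite -ltnS.
  rewrite /s -exprM mulrC coefXnM.
  by case: ltnP => // ge; have -> : (p * r - (p - 1) * n = 0)%N by lia.
case: ltnP => _; first by rewrite big1 // => m _; rewrite scale0r.
transitivity (conv Q P n).
  apply: eq_bigr => m _.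
  by rewrite -horner_coef0 horner_exp !hornerE expr1n scale1r.
by rewrite conv_QP /delta eqn0Ngt n_gt0.
Qed.

Lemma coef_PQ_total n i :
  (conv (total (1 + 'X) P) (total 1 Q) n)`_i = taylor n i.
Proof.
rewrite coef_conv_total; apply: eq_bigr => m _.
by rewrite expr1n mulr1 coef_1addX_exp.
Qed.

(** This is the coefficient of w^r v^q in P(x) Q(z) = (P(x) Q(y)) (P(y) Q(z)) for
    x = 1 + v + w, y = 1 + v and z = 1; the part of degree a of P(x) Q(y) is
    sum_r [taylor a r] w^r (1 + v)^(a-r) by homogeneity. *)
Lemma taylor_cocycle n r q :
  'C(r + q, r)%:R *: taylor n (r + q) =
  \sum_(a < n.+1) \sum_(i < q.+1)
     'C(a - r, i)%:R *: (taylor a r * taylor (n - a) (q - i)).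
Proof.
pose t : {poly F} := 1 + 'X.
(* W is the coefficient of w^r in P(1 + v + w), where v is the polynomial
   variable. *)
pose W := weighted (fun i => 'C(i, r)%:R *: t ^+ (i - r)) P.
have eW : conv W (total 1 Q) =
    conv (conv W (total t Q)) (conv (total t P) (total 1 Q)).
  rewrite convA -[in RHS](convA W) conv_total conv_QP total_delta.
  by rewrite conv1r.
have eWt a : conv W (total t Q) a = polyA (t ^+ (a - r)) * (taylor a r)%:P.
  rewrite /taylor raddf_sum mulr_sumr /=; apply: eq_bigr => i _.
  rewrite weightedM -scalerAl; have [ri|ir] := leqP r i; last first.
    by rewrite bin_small // !scale0r rmorph0 mul0r mulr0.
  rewrite -exprD; have -> : (i - r + (a - i) = a - r)%N by have := ltn_ord i; lia.
  apply/polyP => k; rewrite !coef_polyAM coefZ scalerA; congr (_ *: _).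
  exact: mulrC.
have := congr1 (fun h : nat -> {poly A} => (h n)`_q) eW; rewrite {1}/conv coef_sum => e.
transitivity (\sum_(i < n.+1) (W i * total 1 Q (n - i))`_q).
  rewrite /taylor scaler_sumr; apply: eq_bigr => i _.
  rewrite weightedM coef_polyAM expr1n mulr1 coefZ coef_1addX_exp scalerA -!natrM.
  by rewrite bin_trinomial.
rewrite e /conv coef_sum; apply: eq_bigr => a _.
rewrite -/(conv W _ a) -/(conv _ _ (n - a)) eWt coefM; apply: eq_bigr => i _.
by rewrite coef_polyAM coef_PQ_total coef_1addX_exp scalerAl.
Qed.
End TotalPowers.

(** * The function H and the number l(n) *)

Definition floor_sum (p j : nat) : nat := (\sum_(i < j.+1) j %/ p ^ i)%N.

Section FloorSum.
Variables (p : nat) (p_gt1 : (1 < p)%N).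
Local Notation H := (floor_sum p).
Local Open Scope nat_scope.

Lemma floor_sum_widen N j : j < N -> H j = \sum_(i < N) j %/ p ^ i.
Proof.
move=> jN; rewrite /floor_sum (big_ord_widen N (fun i => j %/ p ^ i)) //.
rewrite [RHS](bigID (fun i : 'I_N => i < j.+1)) /= [X in _ = _ + X]big1 ?addn0 // => i.
by rewrite -leqNgt => ji; rewrite divn_small // (leq_trans _ (ltnW (ltn_expl i p_gt1))).
Qed.

Lemma floor_sumD a b : H a + H b <= H (a + b).
Proof.
rewrite (@floor_sum_widen (a + b).+1 a) ?(@floor_sum_widen (a + b).+1 b) ?ltnS
  ?leq_addr ?leq_addl //.
rewrite -big_split /=; apply: leq_sum => i _.
by rewrite divnD ?expn_gt0 ?(ltnW p_gt1) // leq_addr.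
Qed.

Lemma floor_sum_mono a b : a <= b -> H a <= H b.
Proof. by move=> /subnKC <-; apply: leq_trans (floor_sumD _ _); apply: leq_addr. Qed.

Lemma floor_sum_rec j : H j = j + H (j %/ p).
Proof.
have lt : j %/ p < j.+1 by rewrite ltnS leq_div.
rewrite (floor_sum_widen lt) (@floor_sum_widen j.+2 j) // big_ord_recl divn1.
by congr (_ + _); apply: eq_bigr => i _; rewrite /= /bump add1n expnS divnMA.
Qed.

Lemma floor_sum_ge j : j <= H j.
Proof. by rewrite floor_sum_rec leq_addr. Qed.

Lemma floor_sum0 : H 0 = 0.
Proof. by rewrite /floor_sum big_ord1 div0n. Qed.

Lemma floor_sum_digits j : p * j - digit_sum p j = (p - 1) * H j.
Proof.
have p_gt0 := ltnW p_gt1.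
have e : digit_sum p j + p * (\sum_(i < j.+1) j %/ p ^ i.+1) = H j.
  rewrite big_distrr -big_split; apply: eq_bigr => i _ /=.
  by rewrite expnSr divnMA [in RHS](divn_eq (j %/ p ^ i) p) addnC mulnC.
have e2 : H j = j + \sum_(i < j.+1) j %/ p ^ i.+1.
  by rewrite (@floor_sum_widen j.+2) // big_ord_recl divn1.
rewrite mulnBl mul1n; move: e; rewrite [in (p * H j)%N]e2 mulnDr; lia.
Qed.

Lemma floor_sum_ppow k : ((p - 1) * H (p ^ k)).+1 = p ^ k.+1.
Proof.
have p_gt0 := ltnW p_gt1.
elim: k => [|k IHk].
  rewrite expn0 expn1 floor_sum_rec divn_small // floor_sum0; lia.
rewrite floor_sum_rec [X in X %/ p]expnS mulKn // mulnDr -addnS IHk [RHS]expnS.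
by rewrite -[X in _ + X]mul1n -mulnDl subnK.
Qed.

Lemma leq_ell n j : 0 < n -> (j <= ell p n) = (H j < n).
Proof.
move=> n_gt0; have [le_ell max_ell] := ell_max p_gt1 n_gt0.
have cond i : (p * i - digit_sum p i < (p - 1) * n) = (H i < n).
  by rewrite floor_sum_digits ltn_pmul2l // subn_gt0.
apply/idP/idP => [jl|]; last by rewrite -cond; apply: max_ell.
by rewrite cond in le_ell; apply: leq_ltn_trans le_ell; apply: floor_sum_mono.
Qed.

(** (p^m - 1) / (p - 1), the degree of the Milnor generator xi_m. *)
Definition repunit (m : nat) : nat := \sum_(i < m) p ^ i.

Lemma repunitS m : repunit m.+1 = p ^ m + repunit m.
Proof. by rewrite /repunit big_ord_recr addnC. Qed.

(** Since repunit k.+1 = p^k + repunit k, the exponents must satisfy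
    sum repunit k = n - e.  Those that are nonzero are found by induction, as
    successors of exponents whose powers of p sum to some e' <= e / p; zero
    exponents then bring p e' up to e.  The induction needs
    e' <= n - e <= H(e'), which the choice e' = min(n - e, floor(e / p)) ensures,
    because H(e) = e + H(floor(e / p)). *)
Lemma exists_powers e n : e <= n <= H e ->
  exists s : seq nat, \sum_(k <- s) p ^ k = e /\ \sum_(k <- s) repunit k.+1 = n.
Proof.
elim/ltn_ind: e n => e IHe n /andP[en nH].
have [e0|e_gt0] := posnP e.
  exists [::]; rewrite !big_nil; rewrite e0 floor_sum0 in nH *.
  by split=> //; apply/esym/eqP; rewrite -leqn0.
pose d := n - e; pose e' := minn d (e %/ p).
have e'e : e' < e by rewrite (leq_ltn_trans (geq_minr _ _)) // ltn_Pdiv.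
have dH : d <= H (e %/ p) by rewrite leq_subLR -floor_sum_rec.
have [|s [sum_e sum_d]] := IHe e' e'e d.
  rewrite geq_minl /= /e' /minn.
  by case: ifP => _; [apply: floor_sum_ge | apply: dH].
have pe' : p * e' <= e.
  by rewrite (leq_trans _ (leq_trunc_div e p)) // mulnC leq_mul2r geq_minr orbT.
have sum_s : \sum_(k <- [seq k.+1 | k <- s] ++ nseq (e - p * e') 0) p ^ k = e.
  rewrite big_cat big_map big_nseq iter_addn_0 expn0 mul1n /=.
  under eq_bigr do rewrite expnS; rewrite -big_distrr /= sum_e; lia.
exists ([seq k.+1 | k <- s] ++ nseq (e - p * e') 0); split=> //.
under eq_bigr do rewrite repunitS; rewrite big_split /= sum_s.
rewrite big_cat big_map sum_d big_nseq iter_addn_0 /repunit big_ord0 mul0n /=; lia.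
Qed.
End FloorSum.

(** * Vanishing of the Taylor coefficients *)

Section Vanishing.
Variables (p : nat) (p_pr : prime p) (A : algType 'F_p) (P Q : nat -> A).
Hypothesis P_Adem : Adem_relations P.
Hypothesis P0 : P 0 = 1.
Hypothesis conv_PQ : conv P Q = @delta A.
Local Notation H := (floor_sum p).
Local Notation c := (taylor P Q).

(** Induction on n, then on r; [taylor_eq0_low] covers r = 0 and the powers of p.
    For other r, let p^v be the largest
    power of p dividing r and q = r - p^v; then binom(r, p^v) is nonzero mod p
    and [taylor_cocycle] applies.  In the term of index a, the first factor
    vanishes if H(p^v) < a; otherwise H(q) < n - a, because
    H(p^v) + H(q) <= H(r) < n, and the second factor vanishes. *)
Lemma taylor_eq0 n r : (H r < n)%N -> c n r = 0.
Proof.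
have p1 := prime_gt1 p_pr; have p_gt0 := prime_gt0 p_pr.
elim/ltn_ind: n r => n IHn; elim/ltn_ind => r IHr Hrn.
have n_gt0 : (0 < n)%N by apply: leq_ltn_trans Hrn.
have [r0|r_gt0] := posnP r.
  by rewrite r0; apply: (taylor_eq0_low p_pr P_Adem P0 conv_PQ) => //; rewrite muln0.
have [m co_pm r_def] := pfactor_coprime p_pr r_gt0; set v := logn p r in r_def.
have [m1|m_neq1] := eqVneq m 1%N.
  rewrite m1 mul1n in r_def; apply: (taylor_eq0_low p_pr P_Adem P0 conv_PQ) => //.
  by move: Hrn; rewrite r_def -expnS -floor_sum_ppow // -(ltn_pmul2l (m := p - 1)) ?subn_gt0.
have pv_gt0 : (0 < p ^ v)%N by rewrite expn_gt0 p_gt0.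
have m_gt1 : (1 < m)%N by case: m m_neq1 r_def {co_pm} => [|[]] //; lia.
have pv_r : (p ^ v < r)%N by rewrite r_def ltn_Pmull.
have C_neq0 : 'C(r, p ^ v)%:R != 0 :> 'F_p.
  rewrite r_def mulnC -{2}[(p ^ v)%N]muln1 (bin_ppow (pchar_Fp p_pr)) bin1.
  by rewrite -(dvdn_pcharf (pchar_Fp p_pr)) -prime_coprime.
pose q := (r - p ^ v)%N; have eq_r : (p ^ v + q)%N = r by rewrite subnKC // ltnW.
have q_gt0 : (0 < q)%N by rewrite subn_gt0.
have := taylor_cocycle p_pr P0 conv_PQ n (p ^ v) q; rewrite eq_r.
rewrite big1 => [/eqP|a _]; first by rewrite scaler_eq0 (negPf C_neq0) => /eqP.
apply: big1 => i _.
have an : (a <= n)%N by rewrite -ltnS.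
have Hq i' : (i' <= q)%N -> (H i' <= H q)%N by apply: floor_sum_mono.
have HD := floor_sumD p1 (p ^ v) q; rewrite eq_r in HD.
have [lt_a|le_a] := ltnP (H (p ^ v)) a.
  suff -> : c a (p ^ v) = 0 by rewrite mul0r scaler0.
  move: an; rewrite leq_eqVlt => /orP[/eqP a_n|a_n]; last exact: IHn.
  by rewrite a_n; apply: IHr; rewrite // -a_n.
suff -> : c (n - a)%N (q - i)%N = 0 by rewrite mulr0 scaler0.
have {}Hq : (H (q - i) < n - a)%N by have := Hq _ (leq_subr i q); lia.
have [a0|a_gt0] := posnP a; last by apply: IHn; lia.
by rewrite a0 subn0 in Hq *; apply: IHr; lia.
Qed.
End Vanishing.

(** * The universal property of the reduced powers *)

Section Evaluation.
Variables (p : nat) (S : algType 'F_p) (P : nat -> S).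
Hypothesis P_Adem : Adem_relations P.
Hypothesis P0 : P 0 = 1.

(** For odd p the Bockstein can be sent to 0, as every relation in which it occurs
    has it in all terms; for p = 2 it is Sq^1. *)
Definition eval_letter (i : option nat) : S :=
  if i is Some n then P n else if p == 2%N then P 1 else 0.

Definition eval_word (m : {fmonom (option nat)}) : S :=
  \prod_(i <- (m : seq (option nat))) eval_letter i.

Fact eval_word_morphism : mmorphism eval_word.
Proof.
split; last by rewrite /eval_word fm1 big_nil.
by move=> x y; rewrite /eval_word fmM big_cat.
Qed.
HB.instance Definition _ :=
  monalg.isMultiplicative.Build {fmonom (option nat)} S eval_word eval_word_morphism.

Definition eval : freeAlg p -> S := mmap (in_alg S) eval_word.

Lemma evalB : {morph eval : x y / x - y}. Proof. exact: raddfB. Qed.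
Lemma evalD : {morph eval : x y / x + y}. Proof. exact: raddfD. Qed.
Lemma eval0 : eval 0 = 0. Proof. exact: mmap0. Qed.
Lemma eval1 : eval 1 = 1. Proof. exact: mmap1. Qed.
Lemma evalZ c x : eval (c *: x) = c *: eval x.
Proof. by apply: etrans (mmapZ _ _) _; rewrite -scalerAl mul1r. Qed.
Lemma evalM : {morph eval : x y / x * y}.
Proof.
apply: (commr_mmap_is_multiplicative _).1 => g m m'.
by rewrite /GRing.comm -scalerAl mul1r -scalerAr mulr1.
Qed.
Lemma eval_sum (I : finType) (D : pred I) (F : I -> freeAlg p) :
  eval (\sum_(i | D i) F i) = \sum_(i | D i) eval (F i).
Proof. exact: (big_morph eval evalD eval0). Qed.

Lemma eval_sum0 (I : finType) (D : pred I) (F : I -> freeAlg p) :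
  (forall i, D i -> eval (F i) = 0) -> eval (\sum_(i | D i) F i) = 0.
Proof. by move=> F0; rewrite eval_sum big1. Qed.

Lemma eval_free_letter i : eval (free_letter p i) = eval_letter i.
Proof. by rewrite /eval mmapU /eval_word fmU big_seq1 /= scale1r mul1r. Qed.

Lemma eval_ideal x : steenrod_ideal x -> eval x = 0.
Proof.
elim=> {x} [x|||]; last 1 first.
- by move=> x y z _ y0; rewrite !evalM y0 mulr0 mul0r.
- case.
  + by rewrite evalB eval_free_letter eval1 /= P0 subrr.
  + move=> a b ab; rewrite evalB evalM eval_sum !eval_free_letter /= P_Adem //.
    apply/eqP; rewrite subr_eq0; apply/eqP; apply: eq_bigr => j _.
    by rewrite evalZ evalM !eval_free_letter.
  + by move/eqP=> p2; rewrite evalB !eval_free_letter /= p2 subrr.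
  + move=> p_odd; rewrite evalM eval_free_letter /=.
    by rewrite ifN ?mulr0 //; apply: contraTneq p_odd => ->.
  + move=> a b p_odd _; rewrite evalB evalD.
    have b0 : eval (free_letter p None) = 0.
      by rewrite eval_free_letter /= ifN //; apply: contraTneq p_odd => ->.
    have -> : eval (free_letter p (Some a) * free_letter p None * free_letter p (Some b)) = 0.
      by rewrite !evalM b0 mulr0 mul0r.
    rewrite sub0r; apply/eqP; rewrite oppr_eq0; apply/eqP.
    rewrite [X in X + _]eval_sum0 ?[X in _ + X]eval_sum0 ?addr0 // => j _.
      by rewrite evalZ !evalM b0 mulr0 mul0r scaler0.
    by rewrite evalZ !evalM b0 !mul0r scaler0.
- exact: eval0.
- by move=> x y _ x0 _ y0; rewrite evalB x0 y0 subrr.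
Qed.

Lemma reduced_universal : exists rho : {linear reduced p -> S},
  [/\ rho 1 = 1, {morph rho : x y / x * y} & forall n, rho (Pow p n) = P n].
Proof.
pose ev (x : steenrod p) : S := eval (ofS x).
have evE x : ev (toS x) = eval x.
  have /toS_eqP/eval_ideal := ofSK (toS x).
  by rewrite evalB => /eqP; rewrite subr_eq0 => /eqP.
have ev1 : ev 1 = 1 by rewrite -[1]/(toS 1) evE eval1.
have evM : {morph ev : x y / x * y}.
  by move=> x y; rewrite -[x]ofSK -[y]ofSK -(rmorphM (@toS p)) !evE evalM.
have ev_lin : linear ev.
  move=> a x y; rewrite -[x]ofSK -[y]ofSK.
  have -> : a *: toS (ofS x) + toS (ofS y) = toS (a *: ofS x + ofS y).
    by rewrite toSD toSZ.
  by rewrite !evE evalD evalZ.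
pose rho0 (x : reduced p) := ev (val x).
have rho_lin : linear rho0.
  move=> a x y; rewrite /rho0 -ev_lin; apply: (congr1 ev).
  exact: (linearP (val : reduced p -> steenrod p)).
pose rho : {linear reduced p -> S} :=
  HB.pack rho0 (GRing.isLinear.Build _ _ _ _ rho0 rho_lin).
exists rho; split=> [|x y|n]; rewrite /rho /= /rho0.
- exact: ev1.
- by rewrite -evM; congr ev; exact: (rmorphM (val : reduced p -> steenrod p)).
- by rewrite /= evE eval_free_letter.
Qed.
End Evaluation.

Lemma conv_Pow_chi p : conv (Pow p) (chiPow p) = @delta _.
Proof.
apply: funext => -[|n]; last exact: chiPow_rec.
by rewrite /conv big_ord1 chiPow0 Pow0 mulr1.
Qed.

(** * The action on products of p-th power monomials *)

(** The space has the basis z_1^(p^(j 1)) ... z_N^(p^(j N)), indexed by the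
    functions j; an operator is given by its matrix entries, the entry (j, k)
    being the coefficient of the monomial j in the image of the monomial k.
    Operators which are tensor powers of an operator on one variable are given
    by its entries w a b.  Exponents are truncated at K, which is
    harmless because all operators raise exponents. *)

Section Kernels.
Variables (p : nat) (p_pr : prime p) (N K : nat).
Local Notation F := 'F_p.
Local Notation J := {ffun 'I_N -> 'I_K.+1}.
Local Notation repunit := (repunit p).
Implicit Types (w u : nat -> nat -> F) (x y : {poly F}) (j k : J).

Definition lower w := forall a b, (a < b)%N -> w a b = 0.

(** P^n raises this degree by n, since P^(p^k) sends z^(p^k) to z^(p^(k+1)). *)
Definition total_degree j : nat := (\sum_i repunit (j i))%N.

Definition tensor w j k : F := \prod_i w (j i) (k i).

(** Homogeneous parts are separated by a variable x, whose exponent is the amount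
    by which the operator raises the degree. *)
Definition graded w x (a b : nat) : {poly F} := w a b *: x ^+ (repunit a - repunit b).

Lemma leq_repunit a b : (a <= b)%N -> (repunit a <= repunit b)%N.
Proof. by move=> /subnKC <-; rewrite /repunit big_split_ord leq_addr. Qed.

Lemma tensor_graded w x j k : lower w ->
  tensor w j k *: x ^+ (total_degree j - total_degree k) =
  \prod_i graded w x (j i) (k i).
Proof.
move=> w_low; rewrite scaler_prod; have [low|] := boolP [forall i, (k i <= j i)%N].
  rewrite prodrXr sumnB // => i _.
  by apply: leq_repunit; apply: (forallP low).
case/forallPn => i; rewrite -ltnNge => /w_low w0.
by rewrite /tensor (bigD1 i) //= w0 !mul0r !scale0r.
Qed.

Lemma tensor_lower w j k :
  lower w -> (total_degree j < total_degree k)%N -> tensor w j k = 0.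
Proof.
move=> w_low; have [low|] := boolP [forall i, (k i <= j i)%N].
  by rewrite ltnNge leq_sum // => i _; apply: leq_repunit; apply: (forallP low).
by case/forallPn => i; rewrite -ltnNge => /w_low w0 _; rewrite /tensor (bigD1 i) //= w0 mul0r.
Qed.

Definition degree_part w n j k : F :=
  if total_degree j == (total_degree k + n)%N then tensor w j k else 0.

(** The composite of two tensor powers is the tensor power of the composite, so
    all computations with homogeneous parts reduce to one variable. *)
Lemma degree_part_compose w u x y j k n :
    lower w -> lower u -> total_degree j = (total_degree k + n)%N ->
  \sum_(m < n.+1) (\sum_h degree_part w m j h * degree_part u (n - m) h k)
    *: (x ^+ m * y ^+ (n - m)) =
  \prod_i \sum_(h < K.+1) graded w x (j i) h * graded u y h (k i).
Proof.
move=> w_low u_low jk; rewrite bigA_distr_bigA /=.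
under eq_bigr do rewrite scaler_suml; rewrite exchange_big /=; apply: eq_bigr => h _.
rewrite big_split /= -!tensor_graded //.
rewrite -scalerAl -scalerAr scalerA.
have [jh|hj] := ltnP (total_degree j) (total_degree h).
  rewrite tensor_lower // mul0r scale0r big1 // => m _; rewrite /degree_part ifN ?mul0r ?scale0r //.
  by apply/eqP; lia.
have [hk|kh] := ltnP (total_degree h) (total_degree k).
  rewrite [tensor u _ _]tensor_lower // mulr0 scale0r big1 // => m _.
  by rewrite /degree_part [X in _ * X]ifN ?mulr0 ?scale0r //; apply/eqP; lia.
have mn : (total_degree j - total_degree h < n.+1)%N by lia.
rewrite (bigD1 (Ordinal mn)) //= big1 ?addr0 => [|m].
  rewrite /degree_part !ifT; try by apply/eqP; lia.
  by congr (_ *: (_ * _ ^+ _)); lia.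
rewrite -val_eqE /= => m_neq; rewrite /degree_part ifN ?mul0r ?scale0r //.
by apply: contraNN m_neq => /eqP ->; rewrite addKn.
Qed.

(** The operator z |-> z + z^p on one variable; its parts give the P^n, and
    [chi_entry] is its inverse z |-> z - z^p + z^(p^2) - ... *)
Definition pow_entry (a b : nat) : F := ((a == b) + (a == b.+1))%:R.
Definition chi_entry (a b : nat) : F := if (b <= a)%N then (-1) ^+ (a - b) else 0.

Lemma pow_entry_lower : lower pow_entry.
Proof. by move=> a b ab; rewrite /pow_entry !ltn_eqF // ltnW. Qed.

Lemma chi_entry_lower : lower chi_entry.
Proof. by move=> a b ab; rewrite /chi_entry leqNgt ab. Qed.

Lemma graded_pow_entry x a b :
  graded pow_entry x a b = (a == b)%:R + (a == b.+1)%:R * x ^+ (p ^ b).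
Proof.
rewrite /graded /pow_entry; have [->|ab] := eqVneq a b.
  by rewrite ltn_eqF // subnn expr0 scale1r mul0r addr0.
have [->|ab1] := eqVneq a b.+1; last by rewrite scale0r mul0r addr0.
by rewrite repunitS addnK add0r mul1r scale1r.
Qed.

Lemma graded_pow_entry_sum x (f : nat -> {poly F}) (a : 'I_K.+1) :
  \sum_(h < K.+1) graded pow_entry x a h * f h =
  f a + (if (a : nat) is b.+1 then x ^+ (p ^ b) * f b else 0).
Proof.
under eq_bigr do rewrite graded_pow_entry mulrDl; rewrite big_split /=; congr (_ + _).
  rewrite (bigD1 a) //= eqxx mul1r big1 ?addr0 // => h.
  by rewrite eq_sym -val_eqE => /negPf /= ->; rewrite mul0r.
case: a => -[|b] aK /=; first by rewrite big1 // => h _; rewrite !mul0r.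
have bK : (b < K.+1)%N by apply: ltnW.
rewrite (bigD1 (Ordinal bK)) //= eqxx mul1r big1 ?addr0 // => h.
by rewrite eqSS eq_sym -val_eqE => /negPf /= ->; rewrite !mul0r.
Qed.

(** As P(x) and P(y) are ring homomorphisms, the value on z^(p^b) is the p^b-th
    power of P(x) P(y) z = z + (x + y) z^p + x^p y z^(p^2). *)
Lemma pow_entry_comp x y (a b : 'I_K.+1) :
  \sum_(h < K.+1) graded pow_entry x a h * graded pow_entry y h b =
  (a == b :> nat)%:R + (a == b.+1 :> nat)%:R * (x + y) ^+ (p ^ b)
  + (a == b.+2 :> nat)%:R * (x ^+ p * y) ^+ (p ^ b).
Proof.
rewrite (graded_pow_entry_sum x (fun h => graded pow_entry y h b)) exprMn -exprM -expnS.
rewrite (exprD_ppow (pchar_Fp p_pr)) graded_pow_entry.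
case: a => -[|a] aK /=; first by rewrite !mul0r !addr0.
rewrite graded_pow_entry !eqSS; have [<-|ab] := eqVneq a b.
  by rewrite gtn_eqF // ltn_eqF //=; ring.
have [->|ab1] := eqVneq a b.+1; last by rewrite /=; ring.
by rewrite ?eqxx /=; ring.
Qed.

(** P(x) chi P(1) on z^(p^b): two consecutive terms of the alternating sum
    combine into the factor 1 - x^(p^(a-1)). *)
Lemma pow_chi_entry_comp x (a b : 'I_K.+1) :
  \sum_(h < K.+1) graded pow_entry x a h * graded chi_entry 1 h b =
  (a == b :> nat)%:R +
  (if (b < a)%N then ((-1) ^+ (a - b))%:P * (1 - x ^+ (p ^ a.-1)) else 0).
Proof.
have gd h : graded chi_entry 1 h b = (chi_entry h b)%:P by rewrite /graded expr1n alg_polyC.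
under eq_bigr do rewrite gd.
rewrite (graded_pow_entry_sum x (fun h => (chi_entry h b)%:P)) /chi_entry.
have [ab|ba|->] := ltngtP a b; rewrite ?addr0 ?add0r.
- case: a ab => -[|a] aK //= ab.
  have -> : (b <= a)%N = false by lia.
  by rewrite mulr0.
- case: a ba => -[|a] aK //=; rewrite ltnS => ba; rewrite ba.
  by rewrite subSn // exprS mulN1r polyCN; ring.
- by rewrite subnn expr0; case: (b : nat) => [|c] /=; rewrite ?addr0 // ltnn mulr0 addr0.
Qed.

Lemma degree_part_off (w u : nat -> nat -> F) m m' j k :
    total_degree j <> (total_degree k + (m + m'))%N ->
  \sum_h degree_part w m j h * degree_part u m' h k = 0.
Proof.
move=> jk; apply: big1 => h _; rewrite /degree_part.
case: eqP => [e1|]; last by rewrite mul0r.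
by case: eqP => [e2|]; [case: jk; lia | rewrite mulr0].
Qed.

Lemma prod_eq_ffun j k : \prod_i (j i == k i :> nat)%:R = (j == k)%:R :> {poly F}.
Proof.
have [->|jk] := eqVneq j k; first by rewrite big1 // => i _; rewrite eqxx.
have [i ji] : exists i, j i != k i.
  apply/existsP; apply: contra_neqT jk => /existsPn jk.
  by apply/ffunP => i; have := jk i; rewrite negbK => /eqP.
by rewrite (bigD1 i) //= val_eqE (negPf ji) mul0r.
Qed.

Lemma pow_part0 j k : degree_part pow_entry 0 j k = (j == k)%:R.
Proof.
rewrite /degree_part addn0; case: eqP => [jk|jk]; last by case: eqP => // e; case: jk; rewrite e.
apply: polyC_inj; have := tensor_graded 0 j k pow_entry_lower.
rewrite jk subnn expr0 alg_polyC => ->; rewrite rmorph_nat -prod_eq_ffun.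
apply: eq_bigr => i _; rewrite graded_pow_entry expr0n expn_eq0.
by rewrite (gtn_eqF (prime_gt0 p_pr)) /= mulr0 addr0.
Qed.

(** The entries of P(x) P(y) depend on x + y and x^p y only
    ([pow_entry_comp]). *)
Lemma pow_part_bullett_macdonald j k n : total_degree j = (total_degree k + n)%N ->
  bullett_macdonald p n
    (fun m => \sum_h degree_part pow_entry m j h * degree_part pow_entry (n - m) h k).
Proof.
move=> jk; rewrite /bullett_macdonald (degree_part_compose _ _ pow_entry_lower pow_entry_lower jk).
have := degree_part_compose ('X * (1 - 'X) ^+ (p - 1)) 1 pow_entry_lower pow_entry_lower jk.
under [X in X = _ -> _]eq_bigr do rewrite expr1n mulr1.
move=> ->; apply: eq_bigr => i _; rewrite !pow_entry_comp (addsX (pchar_Fp p_pr)).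
rewrite ['X * _ + 1]addrC mulr1; congr (_ + _ * _ ^+ _).
by rewrite exprMn; apply: mulrC.
Qed.

Lemma pow_part_chi_part j k n : total_degree j = (total_degree k + n)%N ->
  \sum_(m < n.+1) \sum_h degree_part pow_entry m j h * degree_part chi_entry (n - m) h k =
  (j == k)%:R.
Proof.
move=> jk; apply: polyC_inj; have := degree_part_compose 1 1 pow_entry_lower chi_entry_lower jk.
under [X in X = _ -> _]eq_bigr do rewrite !expr1n mulr1 alg_polyC.
rewrite -rmorph_sum /= => ->; rewrite rmorph_nat -prod_eq_ffun.
apply: eq_bigr => i _; rewrite pow_chi_entry_comp expr1n subrr mulr0.
by case: ifP; rewrite addr0.
Qed.

(* Matrices are indexed by ordinals; the shape #|J|.-1.+1 makes them a
   nontrivial ring. *)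
Let card_J : #|J| = #|J|.-1.+1.
Proof. by rewrite prednK //; apply/card_gt0P; exists [ffun=> ord0]. Qed.

Let label (c : 'I_#|J|.-1.+1) : J := enum_val (cast_ord (esym card_J) c).
Let index (j : J) : 'I_#|J|.-1.+1 := cast_ord card_J (enum_rank j).

Let indexK : cancel index label.
Proof. by move=> j; rewrite /label /index cast_ordK enum_rankK. Qed.
Let labelK : cancel label index.
Proof. by move=> c; rewrite /label /index enum_valK cast_ordKV. Qed.

Definition kernel_mx (M : J -> J -> F) : 'M[F]_#|J|.-1.+1 :=
  \matrix_(c, d) M (label c) (label d).

Lemma kernel_mxM (M M' : J -> J -> F) :
  kernel_mx M * kernel_mx M' = kernel_mx (fun j k => \sum_h M j h * M' h k).
Proof.
apply/matrixP => c d; rewrite !mxE (reindex label) /=.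
  by apply: eq_bigr => b _; rewrite !mxE.
by exists index => j _; [apply: labelK | apply: indexK].
Qed.

Definition Pow_mx a := kernel_mx (degree_part pow_entry a).
Definition chi_mx a := kernel_mx (degree_part chi_entry a).

Lemma Pow_mx0 : Pow_mx 0 = 1.
Proof.
by apply/matrixP => c d; rewrite !mxE pow_part0 (can_eq labelK).
Qed.

Lemma Pow_mx_Adem : Adem_relations Pow_mx.
Proof.
move=> a b /andP[_ ab]; rewrite /Pow_mx kernel_mxM.
under eq_bigr do rewrite kernel_mxM.
apply/matrixP => c d; rewrite summxE !mxE.
under [RHS]eq_bigr do rewrite !mxE.
have jab (j : 'I_a.+1) : (p * j <= a)%N -> (j <= a + b)%N.
  by have := ltn_ord j; lia.
have [e|e] := eqVneq (total_degree (label c)) (total_degree (label d) + (a + b))%N;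
  last first.
  rewrite degree_part_off; last exact/eqP.
  by rewrite big1 // => j /jab jj; rewrite degree_part_off ?mulr0 // subnK //; apply/eqP.
have := bullett_macdonald_Adem (pchar_Fp p_pr) (pow_part_bullett_macdonald e) erefl ab.
rewrite addKn => ->.
by apply: eq_bigr => j /jab jj; rewrite subKn.
Qed.

Lemma conv_Pow_chi_mx : conv Pow_mx chi_mx = @delta _.
Proof.
apply: funext => n; rewrite /conv; under eq_bigr do rewrite kernel_mxM.
apply/matrixP => c d; rewrite summxE; under eq_bigr do rewrite mxE.
have -> : @delta 'M[F]_#|J|.-1.+1 n c d = ((n == 0%N) && (label c == label d))%:R.
  rewrite /delta (can_eq labelK); case: eqP => _ /=; first by rewrite mxE.
  by rewrite mxE.
have [e|/eqP e] := eqVneq (total_degree (label c)) (total_degree (label d) + n)%N.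
  rewrite pow_part_chi_part //; case: eqP => [cd|_]; last by rewrite andbF.
  by rewrite cd in e; have -> : n = 0%N by lia.
rewrite big1 => [|m _]; last by rewrite degree_part_off // subnKC // -ltnS.
by case: eqP => [n0|//]; case: eqP => [cd|//]; case: e; rewrite n0 cd addn0.
Qed.

(** The matrix of chi P^m is forced, because inverses for the convolution are
    unique. *)
Lemma relation_entry n j k (v : 'I_n.+1 -> F) : \sum_i v i *: PchiP p n i = 0 ->
  \sum_i v i * (\sum_h degree_part pow_entry i j h * degree_part chi_entry (n - i) h k) = 0.
Proof.
move=> v0; have [rho [rho1 rhoM rhoP]] := reduced_universal Pow_mx_Adem Pow_mx0.
have rho_chi : (fun m => rho (chiPow p m)) = chi_mx.
  apply: (conv_left_inj Pow_mx0); rewrite conv_Pow_chi_mx.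
  apply: funext => m; have := congr1 (fun f => rho (f m)) (conv_Pow_chi p).
  rewrite /conv raddf_sum /= /delta => e; under eq_bigr do rewrite -rhoP -rhoM.
  by rewrite e; case: (m == 0%N); rewrite ?rho1 ?raddf0.
have := congr1 (fun M : 'M_#|J|.-1.+1 => M (index j) (index k)) (congr1 rho v0).
rewrite linear_sum linear0 mxE summxE => e; rewrite -[RHS]e; apply: eq_bigr => i _.
have -> : rho (v i *: PchiP p n i) = v i *: rho (PchiP p n i) by apply: linearZ.
rewrite rhoM rhoP -[rho (chiPow _ _)]/((fun m => rho (chiPow p m)) (n - i)%N).
by rewrite rho_chi kernel_mxM !mxE !indexK.
Qed.
End Kernels.

(** Apply the relation to z_1 ... z_N and take the coefficient of the monomial with
    exponents p^(k_i + 1), for a list of k_i as in [exists_powers]; in the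
    generating function this coefficient is a sign times (1 - x)^e. *)
Lemma relation_orthogonal p n e (v : 'I_n.+1 -> 'F_p) : prime p ->
    (e <= n <= floor_sum p e)%N -> \sum_i v i *: PchiP p n i = 0 ->
  \sum_i v i * ((1 - 'X) ^+ e)`_i = 0.
Proof.
move=> p_pr en v0; have [s [sum_e sum_n]] := exists_powers (prime_gt1 p_pr) en.
pose K := (\max_(k <- s) k).+1; pose N := size s.
pose k0 : {ffun 'I_N -> 'I_K.+1} := [ffun=> ord0].
pose j0 : {ffun 'I_N -> 'I_K.+1} := [ffun i : 'I_N => inord (nth 0%N s i).+1].
have j0E i : j0 i = (nth 0%N s i).+1 :> nat.
  rewrite ffunE inordK // !ltnS.
  by apply: (@leq_bigmax_seq _ s xpredT id) => //; apply: mem_nth.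
have k0E i : k0 i = 0%N :> nat by rewrite ffunE.
have deg_k0 : total_degree p k0 = 0%N.
  by rewrite /total_degree big1 // => i _; rewrite ffunE /repunit big_ord0.
have deg_j0 : total_degree p j0 = (total_degree p k0 + n)%N.
  rewrite deg_k0 add0n -sum_n (big_nth 0%N) big_mkord.
  by apply: eq_bigr => i _; rewrite j0E.
pose G m := \sum_h degree_part (pow_entry p) m j0 h * degree_part (chi_entry p) (n - m) h k0.
pose c : 'F_p := \prod_i (-1) ^+ (j0 i).
have GE (m : 'I_n.+1) : G m = c * ((1 - 'X) ^+ e)`_m.
  have := degree_part_compose p_pr 'X 1 (@pow_entry_lower p) (@chi_entry_lower p) deg_j0.
  under [X in X = _ -> _]eq_bigr do rewrite expr1n mulr1.
  have -> : \prod_i \sum_(h < K.+1) graded (pow_entry p) 'X (j0 i) h * graded (chi_entry p) 1 h (k0 i)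
      = c *: (1 - 'X) ^+ e.
    rewrite -sum_e (big_nth 0%N) big_mkord -prodrXr -scaler_prod; apply: eq_bigr => i _.
    rewrite pow_chi_entry_comp // k0E j0E /= add0r subn0 mul_polyC.
    by rewrite (exprB_ppow (pchar_Fp p_pr)) expr1n.
  move=> /(congr1 (fun f : {poly 'F_p} => f`_m)); rewrite coefZ => <-.
  rewrite coef_sum (bigD1 m) //= coefZ coefXn eqxx mulr1 [X in _ + X]big1 ?addr0 // => i im.
  by rewrite coefZ coefXn eq_sym val_eqE (negPf im) mulr0.
have c_neq0 : c != 0.
  by apply/prodf_neq0 => i _; rewrite expf_neq0 // oppr_eq0 oner_eq0.
have := relation_entry p_pr j0 k0 v0; rewrite -/(G _) => e0.
apply: (mulfI c_neq0); rewrite mulr0 mulr_sumr -[RHS]e0; apply: eq_bigr => i _.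
by rewrite -/(G i) GE mulrCA.
Qed.

(** * Binomial vectors *)

Lemma binz0 x : binz x 0 = 1.
Proof. by have := binzK x 0; rewrite big_ord0 mulr1. Qed.

Lemma binz_pascal x l : binz (x + 1) l.+1 = binz x l.+1 + binz x l.
Proof.
have f_neq0 : (l.+1)`!%:Z != 0 by rewrite eqz_nat -lt0n fact_gt0.
apply: (mulIf f_neq0); rewrite mulrDl !binzK big_ord_recl big_ord_recr /=.
have -> : \prod_(i < l) (x + 1 - (bump 0 i)%:Z) = \prod_(i < l) (x - i%:Z).
  by apply: eq_bigr => i _; rewrite /bump /= add1n -addn1 PoszD; ring.
by rewrite factS PoszM mulrCA binzK -addn1 PoszD; ring.
Qed.

Section BinomialVectors.
Variable F : fieldType.
Local Notation B l x := ((binz x l)%:~R : F).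

Lemma binz_Vandermonde l x (k : nat) :
  B l (x + k%:Z) = \sum_(q < l.+1) 'C(k, q)%:R * B (l - q)%N x.
Proof.
elim: k l => [|k IHk] l.
  rewrite addr0 big_ord_recl bin0 mul1r subn0 big1 ?addr0 // => i _.
  by rewrite bin0n mul0r.
rewrite -addn1 PoszD addrA; case: l => [|l].
  by rewrite big_ord1 bin0 mul1r !binz0.
rewrite binz_pascal rmorphD /= !IHk big_ord_recl [RHS]big_ord_recl !bin0.
rewrite -addrA; congr (_ + _); rewrite -big_split /=; apply: eq_bigr => i _.
by rewrite /bump /= add1n addn1 binS natrD mulrDl subSS.
Qed.

(** As a function of i, binom(x - i, l) is a polynomial of degree l; this is its
    Newton expansion, read off from the finite differences in i, which are again
    of this form by the Pascal rule. *)
Lemma binz_Newton l x : exists c : nat -> F,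
  forall i : nat, B l (x - i%:Z) = \sum_(r < l.+1) c r * 'C(i, r)%:R.
Proof.
elim: l x => [|l IHl] x.
  by exists (fun=> 1) => i; rewrite big_ord1 bin0 binz0 mulr1.
have [c cE] := IHl (x - 1).
exists (fun r => if r is r'.+1 then - c r' else B l.+1 x) => i.
elim: i => [|i IHi].
  rewrite subr0 big_ord_recl bin0 mulr1 big1 ?addr0 // => r _.
  by rewrite bin0n mulr0.
have := binz_pascal (x - i.+1%:Z) l.
have -> : x - i.+1%:Z + 1 = x - i%:Z by rewrite -addn1 PoszD; ring.
have -> : x - i.+1%:Z = x - 1 - i%:Z by rewrite -addn1 PoszD; ring.
move/(congr1 (fun z : int => z%:~R : F)); rewrite rmorphD /= IHi cE => e.
apply: (addIr (\sum_(r < l.+1) c r * 'C(i, r)%:R)); rewrite -e.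
rewrite [LHS]big_ord_recl [X in _ = X + _]big_ord_recl !bin0 -addrA.
congr (_ + _); rewrite -big_split /=.
by apply: eq_bigr => r _; rewrite binS natrD; ring.
Qed.

Lemma unitriangular_inj l (c : nat -> nat -> F) (d : nat -> F) :
    (forall i, c i i = 1) -> (forall i q, (i < q)%N -> (q <= l)%N -> c i q = 0) ->
    (forall i, (i <= l)%N -> \sum_(q < l.+1) c i q * d q = 0) ->
  forall q, (q <= l)%N -> d q = 0.
Proof.
move=> c1 c0 cd; elim/ltn_ind => i IHi il.
have i_lt : (i < l.+1)%N by [].
have := cd i il; rewrite (bigD1 (Ordinal i_lt)) //= c1 mul1r big1 ?addr0 // => q.
rewrite -val_eqE /=; have ql : (q <= l)%N by rewrite -ltnS.
by case: ltngtP => // [qi|iq] _; [rewrite IHi ?mulr0 | rewrite c0 ?mul0r].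
Qed.

(** By the Vandermonde identity in k and in i, the matrix of the
    binom(m + k - i, l), with 0 <= i, k <= l, is a product of three unitriangular
    matrices (up to reversing the order of indices). *)
Lemma binz_window_free l m (a : nat -> F) :
    (forall i : nat, (i <= l)%N -> \sum_(k < l.+1) a k * B l (m + k%:Z - i%:Z) = 0) ->
  forall k, (k <= l)%N -> a k = 0.
Proof.
move=> a0; pose y := m - l%:Z.
have a1 t : (t <= l)%N -> \sum_(k < l.+1) a k * B t (y + k%:Z) = 0.
  move=> tl; rewrite -(subKn tl).
  apply: (@unitriangular_inj l (fun j q => 'C(j, q)%:R)
    (fun q => \sum_(k < l.+1) a k * B (l - q)%N (y + k%:Z))) => [i|i q iq _|j jl|].
  - by rewrite binn.
  - by rewrite bin_small.
  - rewrite -[RHS](a0 (l - j)%N) ?leq_subr //.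
    under eq_bigr do rewrite mulr_sumr; rewrite exchange_big /=.
    apply: eq_bigr => k _.
    have -> : m + k%:Z - (l - j)%N%:Z = y + k%:Z + j%:Z.
      by rewrite /y -subzn //; ring.
    by rewrite binz_Vandermonde mulr_sumr; apply: eq_bigr => q _; rewrite mulrCA.
  - exact: leq_subr.
have a2 r : (r <= l)%N -> \sum_(k < l.+1) a k * 'C(k, r)%:R = 0.
  apply: (@unitriangular_inj l (fun t r => if (r <= t)%N then B (t - r)%N y else 0)
    (fun r => \sum_(k < l.+1) a k * 'C(k, r)%:R)) => [i|i q iq _|t tl].
  - by rewrite leqnn subnn binz0.
  - by rewrite leqNgt iq.
  - rewrite -[RHS](a1 t tl); under eq_bigr do rewrite mulr_sumr.
    rewrite exchange_big /=; apply: eq_bigr => k _; rewrite binz_Vandermonde mulr_sumr.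
    rewrite [RHS](big_ord_widen l.+1 (fun q => a k * ('C(k, q)%:R * B (t - q)%N y))) //.
    rewrite [RHS]big_mkcond /=; apply: eq_bigr => q _; rewrite ltnS.
    by case: leqP => _; ring.
move=> k kl; rewrite -(subKn kl).
apply: (@unitriangular_inj l (fun i q => 'C(l - q, l - i)%:R)
    (fun q => a (l - q)%N)) => [i|i q iq ql|i il|]; last exact: leq_subr.
- by rewrite binn.
- by rewrite bin_small //; lia.
- rewrite -[RHS](a2 (l - i)%N) ?leq_subr // (reindex_inj rev_ord_inj) /=.
  apply: eq_bigr => q _; have ql : (q <= l)%N by rewrite -ltnS.
  by rewrite subSS (subKn ql) mulrC.
Qed.
End BinomialVectors.

(** * Bases of the relations and of their values *)

Section Span.
Variables (R : pzRingType) (V : lmodType R) (I : finType) (D : pred I) (b : I -> V).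

Lemma in_span_vec i : D i -> in_span D b (b i).
Proof.
move=> Di; exists (fun j => (j == i)%:R); rewrite (bigD1 i) //= eqxx scale1r.
by rewrite big1 ?addr0 // => j /andP[_ /negPf ->]; rewrite scale0r.
Qed.

Lemma in_span_sum (J : finType) (E : pred J) (c : J -> R) (x : J -> V) :
  (forall j, E j -> in_span D b (x j)) -> in_span D b (\sum_(j | E j) c j *: x j).
Proof.
move=> xD; apply: (big_ind (in_span D b)) => [|_ _ [u ->] [v ->]|j /xD[u ->]].
- by exists (fun=> 0); rewrite big1 // => i _; rewrite scale0r.
- by exists (fun i => u i + v i); rewrite -big_split; apply: eq_bigr => i _; rewrite scalerDl.
- by exists (fun i => c j * u i); rewrite scaler_sumr; apply: eq_bigr => i _; rewrite scalerA.
Qed.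
End Span.

Section Relations.
Variables (p n : nat) (p_pr : prime p) (n_gt0 : (0 < n)%N).
Local Notation F := 'F_p.
Local Notation l := (ell p n).

Lemma taylor_relation r : (r <= l)%N ->
  \sum_(i < n.+1) 'C(i, r)%:R *: PchiP p n i = 0.
Proof.
rewrite leq_ell ?prime_gt1 // => rn.
exact: (taylor_eq0 p_pr (@Adem_relation p) (Pow0 p) (conv_Pow_chi p) rn).
Qed.

Lemma ell_leq : (l <= n)%N.
Proof.
have := leqnn l; rewrite leq_ell ?prime_gt1 // => /ltnW; apply: leq_trans.
exact: floor_sum_ge (prime_gt1 p_pr) _.
Qed.

(** The polynomials (1 - x)^e with l < e <= n have distinct degrees, so being
    orthogonal to them determines the entries of v of index above l, one at a
    time. *)
Lemma relation_eq0 (v : 'I_n.+1 -> F) : \sum_i v i *: PchiP p n i = 0 ->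
  (forall i : 'I_n.+1, (i <= l)%N -> v i = 0) -> forall i, v i = 0.
Proof.
move=> v0 vl [m]; elim/ltn_ind: m => m IHm mn.
have [ml|lm] := leqP m l; first exact: vl.
have := relation_orthogonal (e := m) p_pr _ v0.
rewrite -ltnS mn leqNgt -leq_ell ?prime_gt1 // -ltnNge lm => /(_ isT).
rewrite (bigD1 (Ordinal mn)) //= coef_1subX_exp binn mulr1 big1 ?addr0 => [|i].
  by move/eqP; rewrite mulf_eq0 signr_eq0 orbF => /eqP.
rewrite -val_eqE /= => im; rewrite coef_1subX_exp.
case: ltngtP im => // [lt_im|mi] _; last by rewrite bin_small // !mulr0.
by case: i lt_im => i iP /= lt_im; rewrite IHm // mul0r.
Qed.

Lemma binom_row_kermu k : binom_row p n l k \in kermu p n.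
Proof.
have [c cE] := binz_Newton F l k.
rewrite mem_kermu; apply/eqP; rewrite /mu.
transitivity (\sum_(r < l.+1) c r *: \sum_(i < n.+1) 'C(i, r)%:R *: PchiP p n i).
  under [RHS]eq_bigr do rewrite scaler_sumr; rewrite exchange_big /=.
  apply: eq_bigr => i _; rewrite mxE cE scaler_suml.
  by apply: eq_bigr => r _; rewrite scalerA.
by apply: big1 => r _; rewrite taylor_relation ?scaler0 // -ltnS.
Qed.

(** By [relation_eq0] a relation is determined by its first l + 1 entries. *)
Lemma dim_kermu : (\dim (kermu p n) <= l.+1)%N.
Proof.
pose f := linfun (colsub (widen_ord (ell_leq : (l.+1 <= n.+1)%N)) : 'rV[F]_n.+1 -> 'rV[F]_l.+1).
have ker0 : (kermu p n :&: lker f = 0)%VS.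
  apply/eqP; rewrite -subv0; apply/subvP => v; rewrite memv_cap memv_ker memv0.
  rewrite mem_kermu lfunE /= => /andP[/eqP v0 /eqP f0].
  have {}v0 : \sum_i v 0 i *: PchiP p n i = 0 by [].
  apply/eqP/rowP => i; rewrite mxE; apply: (relation_eq0 v0) => j jl.
  have jl' : (j < l.+1)%N by [].
  have := congr1 (fun u : 'rV_l.+1 => u 0 (Ordinal jl')) f0; rewrite !mxE => e.
  by rewrite -[RHS]e; congr (v 0 _); apply: val_inj.
rewrite -(limg_ker_dim f) ker0 dimv0 add0n (leq_trans (dimvS (subvf _))) //.
by rewrite dimvf /dim /= mul1n.
Qed.

Lemma binom_row_basis (m : int) :
  basis_of (kermu p n) [tuple binom_row p n l (m + k%:Z) | k < l.+1].
Proof.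
rewrite basisEfree size_tuple dim_kermu andbT; apply/andP; split.
  apply/freeP => a a0 k.
  pose a' j := if insub j is Some i then a i else 0.
  have a'E (i : 'I_l.+1) : a' i = a i by rewrite /a' valK.
  rewrite -a'E; apply: (@binz_window_free F l m); last by rewrite -ltnS.
  move=> i il; have iN : (i < n.+1)%N by rewrite ltnS (leq_trans il ell_leq).
  have := congr1 (fun u : 'rV_n.+1 => u 0 (Ordinal iN)) a0.
  rewrite summxE mxE => e; rewrite -[RHS]e; apply: eq_bigr => j _.
  by rewrite mxE -tnth_nth tnth_mktuple mxE a'E.
apply/span_subvP => _ /mapP[k _ ->]; exact: binom_row_kermu.
Qed.

(** For r <= l the relation [taylor_relation] has first nonzero entry 1, at r, and
    expresses P^r chi P^(n-r) by terms of larger index. *)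
Lemma PchiP_in_span (i : 'I_n.+1) :
  in_span [pred i : 'I_n.+1 | (l + 1 <= i)%N] (fun i : 'I_n.+1 => PchiP p n i) (PchiP p n i).
Proof.
set D := [pred i : 'I_n.+1 | _]; set b := fun i : 'I_n.+1 => _.
suff span k : forall i : 'I_n.+1, (n - i < k)%N -> in_span D b (b i).
  by apply: (span n.+1); rewrite ltnS leq_subr.
elim: k => // k IHk {}i ik.
have [li|il] := ltnP l i; first by apply: in_span_vec; rewrite inE addn1.
have := taylor_relation il; rewrite (bigD1 i) //= binn scale1r => /eqP.
rewrite addr_eq0 => /eqP; rewrite -/(b i) => ->; rewrite -sumrN.
under eq_bigr do rewrite -scaleNr; rewrite (bigID (fun j : 'I_n.+1 => (j < i)%N)) /=.
rewrite big1 ?add0r => [|j /andP[_ ji]]; last by rewrite bin_small // oppr0 scale0r.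
apply: (@in_span_sum _ _ _ D b _ _ _ b) => j /andP[ji].
rewrite -leqNgt leq_eqVlt eq_sym val_eqE.
rewrite (negPf ji) /= => ij; apply: IHk.
by have := ltn_ord j; lia.
Qed.

Lemma PchiP_basis :
  is_basis [pred i : 'I_n.+1 | (l + 1 <= i)%N] (fun i : 'I_n.+1 => PchiP p n i) (@Vspan p n).
Proof.
set D := [pred i : 'I_n.+1 | _]; split=> [c c0 i Di|x]; last first.
  split=> [[c ->]|[c ->]]; first by apply: in_span_sum => i _; apply: PchiP_in_span.
  exists (fun i => if D i then c i else 0); rewrite [LHS]big_mkcond /=.
  by apply: eq_bigr => i _; case: ifP => //; rewrite scale0r.
have := @relation_eq0 (fun i => if D i then c i else 0).
rewrite big_mkcond /= in c0; move=> rel.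
have := rel _ _ i; rewrite Di; apply.
  by rewrite -[RHS]c0; apply: eq_bigr => j _ /=; case: ifP => // _; rewrite scale0r.
by move=> j jl; rewrite inE addn1 ltnNge jl.
Qed.
End Relations.

Theorem theorem1p4 (p n : nat) (p_prime : prime p) (n_gt0 : (0 < n)%N) :
  (forall m : int,
     basis_of (kermu p n)
       [tuple binom_row p n (ell p n) (m + k%:Z) | k < (ell p n).+1]) /\
  is_basis [pred i : 'I_n.+1 | (ell p n + 1 <= i)%N]
    (fun i : 'I_n.+1 => PchiP p n i) (@Vspan p n).
Proof.
split; first exact: binom_row_basis.
exact: PchiP_basis.
Qed.
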